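(* Let $G$ be a 3-dimensional unimodular Lie group with an orientation, a left-invariant metric $g$, a Milnor frame $(e_1,e_2,e_3)$ with Milnor constants $(\lambda_1,\lambda_2,\lambda_3)$ and dual coframe $(\theta^1,\theta^2,\theta^3)$, in one of the following three cases, and define a 4-dimensional Riemannian manifold $(\mathcal Z,g^{\mathcal Z})$ as indicated. (i) $\mathfrak g\cong\mathfrak{heis}_3$, $G$ connected, $\lambda_1\neq0$, $\lambda_2=\lambda_3=0$, $\mu=-\frac1{2\lambda_1}$; $\mathcal Z=I\times G$, where $I\ni0$ is an open interval on which $1-\frac{3\lambda_1}2t>0$, with hypersurface $\{t=0\}$ and $$g^{\mathcal Z}=dt^2+\Bigl(1-\tfrac{3\lambda_1}2t\Bigr)^{-2/3}(\theta^1)^2+\Bigl(1-\tfrac{3\lambda_1}2t\Bigr)^{2/3}\bigl((\theta^2)^2+(\theta^3)^2\bigr).$$ (ii) $\mathfrak g\cong\mathfrak{iso}(2)$, $G$ simply connected, $\lambda_1,\lambda_2>0$, $\lambda_1\ne\lambda_2$, $\lambda_3=0$, $\mu=-\frac1{2(\lambda_1+\lambda_2)}$, $q=\sqrt{\lambda_1\lambda_2}$; $s_0>0$ is defined by $\tanh(s_0)=\sqrt{\lambda_1/\lambda_2}$ if $\lambda_1<\lambda_2$ and $\tanh(s_0)=\sqrt{\lambda_2/\lambda_1}$ if $\lambda_1>\lambda_2$; $\mathcal Z=(0,\infty)\times G$ with coordinate $s\in(0,\infty)$, hypersurface $\{s=s_0\}$, and $$g^{\mathcal Z}=\frac{|\lambda_1-\lambda_2|}{2q^3}\sinh(2s)\exp\Bigl(-\frac{4q}{\lambda_1+\lambda_2}(s-s_0)\Bigr)\bigl(ds^2+q^2(\theta^3)^2\bigr)+h,$$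 where $h=\frac q{\lambda_1}\tanh(s)(\theta^1)^2+\frac{\lambda_1}{q\tanh(s)}(\theta^2)^2$ if $\lambda_1<\lambda_2$ and $h=\frac q{\lambda_1\tanh(s)}(\theta^1)^2+\frac{\lambda_1}q\tanh(s)(\theta^2)^2$ if $\lambda_1>\lambda_2$. (iii) $\mathfrak g\cong\mathfrak{iso}(1,1)$, $G$ simply connected, $\lambda_1>0>\lambda_2$, $\lambda_1+\lambda_2\neq0$, $\lambda_3=0$, $\mu=-\frac1{2(\lambda_1+\lambda_2)}$, $q=\sqrt{-\lambda_1\lambda_2}$; $s_0\in(0,\frac\pi2)$ is defined by $\tan(s_0)=\lambda_1/q$; $\mathcal Z=(0,\frac\pi2)\times G$ with coordinate $s\in(0,\frac\pi2)$, hypersurface $\{s=s_0\}$, and $$g^{\mathcal Z}=\frac{\lambda_1-\lambda_2}{2q^3}\sin(2s)\exp\Bigl(-\frac{4q}{\lambda_1+\lambda_2}(s-s_0)\Bigr)\bigl(ds^2+q^2(\theta^3)^2\bigr)+\frac q{\lambda_1}\tan(s)(\theta^1)^2+\frac{\lambda_1}{q\tan(s)}(\theta^2)^2.$$ Then in each case the metric induced on the indicated hypersurface, identified with $G$, is $g$; $(\mathcal Z,g^{\mathcal Z})$ is Ricci-flat; for every non-Killing Ricci Killing spinor $\psi$ on $(G,g)$ with constant $\mu$ (in case (i): every non-zero invariant spinor $\psi$), $(\mathcal Z,g^{\mathcal Z})$ carries a parallel spinor whose restriction to the hypersurface is $\psi$; and the Weingarten tensor of the hypersurface is $W=2\mu\,\mathrm{Ric}$,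 where $\mathrm{Ric}$ is the Ricci tensor of $(G,g)$.
   Context: A Milnor frame is a positively oriented left-invariant orthonormal frame with $[e_2,e_3]=\lambda_1e_1$, $[e_3,e_1]=\lambda_2e_2$, $[e_1,e_2]=\lambda_3e_3$; the real numbers $\lambda_i$ are the Milnor constants. $\mathfrak{heis}_3$ is the 3-dimensional Heisenberg Lie algebra, and $\mathfrak{iso}(2)$, $\mathfrak{iso}(1,1)$ are the Lie algebras of the isometry groups of the Euclidean plane and the Minkowski plane. The forms $\theta^i$ are pulled back to $\mathcal Z$ by the projection to $G$. $G$ carries the spin structure trivialized by left-invariant frames, so $\Sigma G\cong G\times\Sigma_3$, $\Sigma_3\cong\mathbb{C}^2$; invariant spinors are those constant in this trivialization. Clifford multiplication satisfies $X\cdot Y\cdot+Y\cdot X\cdot=-2g(X,Y)$, with $e_1\cdot e_2\cdot=e_3\cdot$ for a positive orthonormal frame. A Ricci Killing spinor with constant $\mu\in\mathbb{R}\setminus\{0\}$ is a non-zero spinor field with $\nabla_X\psi=\mu\,\mathrm{Ric}(X)\cdot\psi$ for all $X$ ($\mathrm{Ric}$ viewed as an endomorphism); it is a Killing spinor if it also satisfies $\nabla_X\psi=\kappa X\cdot\psi$ for a constant $\kappa$. The Weingarten tensor is $W(X)=-\nabla^{\mathcal Z}_X\partial_t$ with unit normal $\partial_t$. In case (i) $\partial_t$ is the coordinate field. In cases (ii), (iii) put $U_3(s)=g^{\mathcal Z}(e_3,e_3)^{1/2}$ (so $U_3(s_0)=1$); the parameter $t$ vanishes at $s=s_0$ and satisfies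 $ds/dt=-q/U_3$ in case (ii) and $ds/dt=q/U_3$ in case (iii), so that $g^{\mathcal Z}=dt^2+g_t$. $\mathcal Z$ carries the spin structure induced from $G$; restriction of spinors uses the standard identification of the appropriate half-spinor bundle of $\mathcal Z$ along the hypersurface with $\Sigma G$, under which Clifford multiplication by $X\in TG$ on $\Sigma G$ corresponds to $\partial_t\cdot X\cdot$ on $\mathcal Z$. *)

(* Defs.v *)
From HB Require Import structures.
From mathcomp Require Import all_boot all_order all_algebra.
From mathcomp Require Import complex.
From mathcomp Require Import all_classical all_reals all_analysis.

Set Implicit Arguments.
Unset Strict Implicit.
Unset Printing Implicit Defensive.

Import Order.TTheory GRing.Theory Num.Theory.
Import numFieldNormedType.Exports.

Local Open Scope classical_set_scope.
Local Open Scope ring_scope.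
Local Open Scope complex_scope.

(* C^k on an open set U; the recursion on directional derivatives is the usual
   notion when V is finite-dimensional, the only case used. *)
Fixpoint Ck (R : realType) (V W : normedModType R) (k : nat) (U : set V)
    (f : V -> W) : Prop :=
  if k is k'.+1 then
    (forall x, U x -> differentiable f x) /\
    (forall v : V, Ck k' U (fun x => 'D_v f x))
  else forall x, U x -> {for x, continuous f}.

Definition smooth_on (R : realType) (V W : normedModType R) (U : set V)
    (f : V -> W) : Prop := forall k, Ck k U f.

Record chart (R : realType) (n : nat) (T : topologicalType) := Chart {
  dom : set T;
  fwd : T -> 'rV[R]_n;
  bwd : 'rV[R]_n -> T;
  img := fwd @` dom;
  dom_open : open dom;
  img_open : open img;
  fwdK : forall x, dom x -> bwd (fwd x) = x;
  fwd_continuous : forall x, dom x -> {for x, continuous fwd};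
  bwd_continuous : forall u, img u -> {for u, continuous bwd} }.

Record lieGroup (R : realType) (n : nat) := LieGroup {
  lg_sort :> topologicalType;
  lg_mul : lg_sort -> lg_sort -> lg_sort;
  lg_one : lg_sort;
  lg_inv : lg_sort -> lg_sort;
  lg_mulA : associative lg_mul;
  lg_mul1 : left_id lg_one lg_mul;
  lg_mulV : left_inverse lg_one lg_inv lg_mul;
  lg_hausdorff : hausdorff_space lg_sort;
  lg_countable : @second_countable lg_sort;
  atlas : set (chart R n lg_sort);
  atlas_cover : forall x, exists2 c, atlas c & dom c x;
  atlas_smooth : forall c d, atlas c -> atlas d ->
    smooth_on (img c `&` bwd c @^-1` dom d) (fwd d \o bwd c);
  lg_mul_continuous :
    continuous (fun xy : lg_sort * lg_sort => lg_mul xy.1 xy.2);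
  lg_mul_smooth : forall a b c, atlas a -> atlas b -> atlas c ->
    smooth_on [set u : 'rV[R]_n * 'rV[R]_n | [/\ img a u.1, img b u.2 &
                 dom c (lg_mul (bwd a u.1) (bwd b u.2))]]
      (fun u => fwd c (lg_mul (bwd a u.1) (bwd b u.2)));
  lg_inv_continuous : continuous lg_inv;
  lg_inv_smooth : forall a c, atlas a -> atlas c ->
    smooth_on (img a `&` [set u | dom c (lg_inv (bwd a u))])
      (fun u => fwd c (lg_inv (bwd a u))) }.

Definition simply_connected (R : realType) (T : topologicalType) : Prop :=
  (forall x y : T, exists f : R -> T,
     [/\ {within `[0, 1]%classic, continuous f}, f 0 = x & f 1 = y]) /\
  (forall f : R -> T, {within `[0, 1]%classic, continuous f} -> f 0 = f 1 ->
     exists H : R * R -> T,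
       {within `[0, 1]%classic `*` `[0, 1]%classic, continuous H} /\
       forall t : R, 0 <= t <= 1 ->
         [/\ H (0, t) = f t, H (1, t) = f 0, H (t, 0) = f 0 & H (t, 1) = f 0]).

Section LieGroup.
Variables (R : realType) (n : nat) (G : lieGroup R n).

Definition smooth_fun (f : G -> R) : Prop :=
  forall c, atlas c -> smooth_on (img c) (f \o bwd c : _ -> R^o).

Definition smooth_curve (y : R -> G) : Prop :=
  continuous y /\
  forall c, atlas c ->
    smooth_on ((y : R^o -> G) @^-1` dom c) (fwd c \o y : R^o -> _).

(* The left-invariant vector field x |-> dL_x(v), acting on functions, where v
   in T_1 G is the velocity at 0 of a smooth curve y with y(0) = 1. *)
Definition left_field (y : R -> G) (f : G -> R) (x : G) : R :=
  derive1 (fun t : R => f (lg_mul x (y t))) 0.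

Definition tangent_basis (e : 'I_n -> R -> G) : Prop :=
  forall c, atlas c -> dom c (lg_one G) ->
    (\matrix_i derive1 (fwd c \o e i) 0) \in unitmx.

End LieGroup.

(* The manifold is the subset D of M, with a global frame (E_a), vector fields
   being identified with derivations. A vector field is given by its components
   in this frame, and h a b = g(E_a, E_b), [E_a, E_b] = \sum_k c a b k E_k,
   nabla_(E_a) E_b = \sum_k Gam a b k E_k. *)

Section FramedManifold.
Variables (R : realType) (M : Type) (n : nat) (D : set M).
Variable E : 'I_n -> (M -> R) -> M -> R.

Implicit Types (c Gam : 'I_n -> 'I_n -> 'I_n -> M -> R).
Implicit Types (h : 'I_n -> 'I_n -> M -> R) (X Y : M -> 'rV[R]_n).

Definition frame_brackets (smooth : (M -> R) -> Prop) c : Prop :=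
  forall f, smooth f -> forall a b p, D p ->
    E a (E b f) p - E b (E a f) p = \sum_k c a b k p * E k f p.

Definition levi_civita c h Gam : Prop :=
  forall p, D p ->
    (forall a b k, Gam a b k p - Gam b a k p = c a b k p) /\
    (forall a b d, E a (h b d) p =
       \sum_k (Gam a b k p * h k d p + Gam a d k p * h b k p)).

Definition inner h X Y (p : M) : R :=
  \sum_a \sum_b X p 0 a * Y p 0 b * h a b p.

Definition nabla Gam (a : 'I_n) X (p : M) : 'rV[R]_n :=
  \row_k (E a (fun q => X q 0 k) p + \sum_b X p 0 b * Gam a b k p).

(* R(E_a, E_b) X *)
Definition curvature c Gam (a b : 'I_n) X (p : M) : 'rV[R]_n :=
  nabla Gam a (nabla Gam b X) p - nabla Gam b (nabla Gam a X) p
  - \sum_k c a b k p *: nabla Gam k X p.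

(* Ric(E_b, E_d) = trace of V |-> R(V, E_b) E_d *)
Definition ricci c Gam (b d : 'I_n) (p : M) : R :=
  \sum_a curvature c Gam a b (fun=> delta_mx 0 d) p 0 a.

Definition orthonormal h (eps : 'I_n -> M -> 'rV[R]_n) : Prop :=
  forall p, D p -> forall a b, inner h (eps a) (eps b) p = (a == b)%:R.

Definition smooth_spinor (smooth : (M -> R) -> Prop) (m : nat)
    (psi : M -> 'cV[R[i]]_m) : Prop :=
  forall j, smooth (fun q => complex.Re (psi q j 0)) /\
            smooth (fun q => complex.Im (psi q j 0)).

Definition spinor_deriv (m : nat) (a : 'I_n) (psi : M -> 'cV[R[i]]_m) (p : M) :
    'cV[R[i]]_m :=
  \col_j (E a (fun q => complex.Re (psi q j 0)) p +i* E a (fun q => complex.Im (psi q j 0)) p).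

(* The spin connection along E_a on the spinor bundle trivialized by the
   orthonormal frame eps, cl b being Clifford multiplication by eps b. *)
Definition spin_nabla (m : nat) h Gam (eps : 'I_n -> M -> 'rV[R]_n)
    (cl : 'I_n -> 'M[R[i]]_m) (a : 'I_n) (psi : M -> 'cV[R[i]]_m) (p : M) :
    'cV[R[i]]_m :=
  spinor_deriv a psi p +
  4^-1 *: \sum_b \sum_d (inner h (nabla Gam a (eps b)) (eps d) p)%:C *:
    (cl b *m cl d *m psi p).

End FramedManifold.

Section LieAlgebra3.
Variable R : realType.

Definition triple (T : Type) (x1 x2 x3 : T) (i : 'I_3) : T :=
  nth x3 [:: x1; x2] i.

(* Structure constants with [e2,e3] = l1 e1, [e3,e1] = l2 e2, [e1,e2] = l3 e3;
   the sums of indices are modulo 3. *)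
Definition milnor_const (l1 l2 l3 : R) (i j k : 'I_3) : R :=
  if (j == i + 1) && (k == i + 2) then triple l1 l2 l3 k
  else if (i == j + 1) && (k == j + 2) then - triple l1 l2 l3 k
  else 0.

Implicit Types c : 'I_3 -> 'I_3 -> 'I_3 -> R.

Definition lie_bracket c (v w : 'rV[R]_3) : 'rV[R]_3 :=
  \row_k \sum_i \sum_j v 0 i * w 0 j * c i j k.

Definition lie_isomorphic c c' : Prop :=
  exists2 P : 'M[R]_3, P \in unitmx &
    forall v w, lie_bracket c' (v *m P) (w *m P) = lie_bracket c v w *m P.

(* tr (ad v) = 0 for all v *)
Definition unimodular c : Prop :=
  forall v, \sum_i lie_bracket c v (delta_mx 0 i) 0 i = 0.

Definition heis3 := milnor_const 1 0 0.
(* translations e1, e2; e3 is the rotation: [e3,e1] = e2, [e3,e2] = - e1 *)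
Definition iso2 := milnor_const 1 1 0.
(* translations e1, e2; e3 is the boost: [e3,e1] = e2, [e3,e2] = e1 *)
Definition iso11 := milnor_const (-1) 1 0.

End LieAlgebra3.

Section MilnorFrame.
Variables (R : realType) (G : lieGroup R 3).

Definition lift_const (c : 'I_3 -> 'I_3 -> 'I_3 -> R) i j k (_ : G) : R :=
  c i j k.

(* A frame of left-invariant fields determines the left-invariant metric and
   the orientation for which it is orthonormal and positive, and gram and
   clifford3 are written for these; e i is a curve representing the value of
   the i-th field at the identity. *)
Definition frame (e : 'I_3 -> R -> G) (i : 'I_3) : (G -> R) -> G -> R :=
  left_field (e i).

Definition gram (i j : 'I_3) (_ : G) : R := (i == j)%:R.

Definition std_frame (i : 'I_3) (_ : G) : 'rV[R]_3 := delta_mx 0 i.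

Definition milnor_frame (e : 'I_3 -> R -> G) (l1 l2 l3 : R) : Prop :=
  [/\ forall i, smooth_curve (e i) /\ e i 0 = lg_one G,
      tangent_basis e &
      frame_brackets setT (frame e) (@smooth_fun R 3 G)
        (lift_const (milnor_const l1 l2 l3))].

Definition clifford3 (cl : 'I_3 -> 'M[R[i]]_2) : Prop :=
  (forall i j, cl i *m cl j + cl j *m cl i = (- 2 * (i == j)%:R)%:M) /\
  cl 0 *m cl 1 = cl 2.

Variables (e : 'I_3 -> R -> G) (c : 'I_3 -> 'I_3 -> 'I_3 -> R).
Variables (Gam : 'I_3 -> 'I_3 -> 'I_3 -> G -> R) (cl : 'I_3 -> 'M[R[i]]_2).

Definition ricci_endo (i : 'I_3) (x : G) : 'rV[R]_3 :=
  \row_j ricci (frame e) (lift_const c) Gam i j x.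

Definition cliff (X : 'rV[R]_3) : 'M[R[i]]_2 := \sum_i (X 0 i)%:C *: cl i.

Definition nablaG : 'I_3 -> (G -> 'cV[R[i]]_2) -> G -> 'cV[R[i]]_2 :=
  spin_nabla (frame e) gram Gam std_frame cl.

Definition ricci_killing (mu : R) (psi : G -> 'cV[R[i]]_2) : Prop :=
  [/\ mu != 0, smooth_spinor (@smooth_fun R 3 G) psi,
      exists x, psi x != 0 &
      forall i x,
        nablaG i psi x = mu%:C *: (cliff (ricci_endo i x) *m psi x)].

Definition killing (psi : G -> 'cV[R[i]]_2) : Prop :=
  exists kappa : R, forall i x, nablaG i psi x = kappa%:C *: (cl i *m psi x).

Definition nonkilling_ricci_killing (mu : R) (psi : G -> 'cV[R[i]]_2) : Prop :=
  ricci_killing mu psi /\ ~ killing psi.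

Definition nonzero_invariant (psi : G -> 'cV[R[i]]_2) : Prop :=
  exists2 v, v != 0 & forall x, psi x = v.

End MilnorFrame.

Section Cylinder.
Variables (R : realType) (G : lieGroup R 3) (J : set R).

(* index lshift 3 ord0 is d/ds, index rshift 1 i is e_i *)
Definition frameZ (e : 'I_3 -> R -> G) (a : 'I_(1 + 3)) (F : R * G -> R)
    (p : R * G) : R :=
  match fintype.split a with
  | inl _ => derive1 (fun s : R => F (s, p.2)) p.1
  | inr i => frame e i (fun x => F (p.1, x)) p.2
  end.

Definition domZ : set (R * G) := J `*` setT.

Definition smooth_funZ (F : R * G -> R) : Prop :=
  forall c : chart R 3 G, atlas c ->
    smooth_on ((J : set R^o) `*` img c)
      ((fun u => F (u.1, bwd c u.2)) : R^o * 'rV[R]_3 -> R^o).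

(* A0 ds^2 + A_1 (theta^1)^2 + A_2 (theta^2)^2 + A_3 (theta^3)^2 *)
Definition gramZ (A0 : R -> R) (A : 'I_3 -> R -> R) (a b : 'I_(1 + 3))
    (p : R * G) : R :=
  diag_mx (row_mx (A0 p.1)%:M (\row_i A i p.1)) a b.

(* the unit normal d/dt = (ds/dt) d/ds and the normalized e_i; sdot = ds/dt *)
Definition orthoZ (sdot : R -> R) (A : 'I_3 -> R -> R) (a : 'I_(1 + 3))
    (p : R * G) : 'rV[R]_(1 + 3) :=
  match fintype.split a with
  | inl _ => row_mx (sdot p.1)%:M 0
  | inr i => row_mx 0 ((Num.sqrt (A i p.1))^-1 *: delta_mx 0 i)
  end.

(* Clifford multiplication on Sigma_4 = Sigma_4^+ + Sigma_4^-, both half-spinor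
   spaces being identified with C^2 so that cl4 0 *m cl4 i acts as cl i on the
   first one, see clifford4_half below. *)
Definition clifford4 (cl : 'I_3 -> 'M[R[i]]_2) (a : 'I_(1 + 3)) :
    'M[R[i]]_(2 + 2) :=
  match fintype.split a with
  | inl _ => block_mx 0 (- 1%:M) 1%:M 0
  | inr i => block_mx 0 (- cl i) (- cl i) 0
  end.

Definition half_spinor (Psi : R * G -> 'cV[R[i]]_(2 + 2)) : Prop :=
  forall p, domZ p -> dsubmx (Psi p) = 0.

Definition restriction (s0 : R) (Psi : R * G -> 'cV[R[i]]_(2 + 2)) (x : G) :
    'cV[R[i]]_2 := usubmx (Psi (s0, x)).

(* The conclusion for the metric gramZ A0 A, the hypersurface {s = s0} and the
   unit normal sdot d/ds; spinors is the class of spinors to be extended. *)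
Definition ricci_flat_extension (e : 'I_3 -> R -> G)
    (cG : 'I_3 -> 'I_3 -> 'I_3 -> R) (GamG : 'I_3 -> 'I_3 -> 'I_3 -> G -> R)
    (cl : 'I_3 -> 'M[R[i]]_2) (mu s0 : R) (A0 : R -> R) (A : 'I_3 -> R -> R)
    (sdot : R -> R) (spinors : (G -> 'cV[R[i]]_2) -> Prop) : Prop :=
  let E := frameZ e in
  let h := gramZ A0 A in
  let eps := orthoZ sdot A in
  exists c Gam : 'I_(1 + 3) -> 'I_(1 + 3) -> 'I_(1 + 3) -> R * G -> R,
    [/\ frame_brackets domZ E smooth_funZ c,
        levi_civita domZ E c h Gam &
        orthonormal domZ h eps] /\
    [/\ forall i j x,
          h (rshift 1 i) (rshift 1 j) (s0, x) = gram i j x,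
        forall a b p, domZ p -> ricci E c Gam a b p = 0,
        forall psi, spinors psi ->
          exists Psi : R * G -> 'cV[R[i]]_(2 + 2),
            [/\ smooth_spinor smooth_funZ Psi, half_spinor Psi,
                forall a p, domZ p ->
                  spin_nabla E h Gam eps (clifford4 cl) a Psi p = 0 &
                forall x, restriction s0 Psi x = psi x] &
        (* W(e_i) = - nabla_(e_i) (d/dt), with W(e_i) tangent to G *)
        forall i x,
          - nabla E Gam (rshift 1 i) (eps (lshift 3 ord0)) (s0, x) =
          row_mx 0 (2 * mu *: ricci_endo e cG GamG i x)].

End Cylinder.

Lemma clifford4_half (R : realType) (cl : 'I_3 -> 'M[R[i]]_2) (i : 'I_3)
    (v : 'cV[R[i]]_2) :
  clifford4 cl (lshift 3 ord0) *m clifford4 cl (rshift 1 i) *m col_mx v 0 =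
  col_mx (cl i *m v) 0.
Proof.
rewrite /clifford4 (unsplitK (inl _)) (unsplitK (inr _)) mulmx_block.
by rewrite mul_block_col !(mul0mx, mulmx0, mul1mx, mulNmx, addr0, add0r, opprK).
Qed.

Lemma clifford4P (R : realType) (cl : 'I_3 -> 'M[R[i]]_2) : clifford3 cl ->
  forall a b,
    clifford4 cl a *m clifford4 cl b + clifford4 cl b *m clifford4 cl a =
    (- 2 * (a == b)%:R)%:M.
Proof.
move=> [clE _] a b; rewrite /clifford4.
have E0 (x : R[i]) : x%:M = block_mx x%:M 0 0 x%:M :> 'M[R[i]]_(2 + 2).
  exact: scalar_mx_block.
have E2 : (- 2 * 1 : R[i])%:M = - 1%:M - 1%:M :> 'M[R[i]]_2.
  by rewrite -opprD -raddfD mulr1 -raddfN.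
have E3 : (- 2 * 0 : R[i])%:M = 0 :> 'M[R[i]]_2 by rewrite mulr0 raddf0.
rewrite E0 -(splitK a) -(splitK b).
case: (fintype.split a) => i; case: (fintype.split b) => j;
  rewrite !unsplitK /=;
  rewrite !mulmx_block add_block_mx;
  rewrite !(mul0mx, mulmx0, addr0, add0r) !(mulNmx, mulmxN) ?opprK;
  rewrite ?mul1mx ?mulmx1.
- by rewrite !ord1 eqxx E2.
- by rewrite eq_lrshift E3 subrr addNr.
- by rewrite eq_rlshift E3 subrr addNr.
- by rewrite eq_rshift !clE.
Qed.

Definition sinh (R : realType) (x : R) : R := (expR x - expR (- x)) / 2.
Definition cosh (R : realType) (x : R) : R := (expR x + expR (- x)) / 2.
Definition tanh (R : realType) (x : R) : R := sinh x / cosh x.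

(* Main.v *)
Require Import Defs.
From HB Require Import structures.
From mathcomp Require Import all_boot all_order all_algebra.
From mathcomp Require Import complex.
From mathcomp Require Import all_classical all_reals all_analysis.
From mathcomp Require Import ring lra.

Import Order.TTheory GRing.Theory Num.Theory.
Import numFieldNormedType.Exports.

Local Open Scope classical_set_scope.
Local Open Scope ring_scope.

(** Write the metric as dt^2 + sum_i U_i^2 (theta^i)^2. In the frame d/dt,
    e_i / U_i the spin connection on positive half-spinors, read on
    G x Sigma_3, is d/dt in the normal direction and

      e_i + (1/2) (U_i' + U_i M_i) cl_i

    along e_i, where M_1 = (L_2 + L_3 - L_1) / 2 (and cyclically) is built from
    the Milnor constants L_1 = l_1 U_1 / (U_2 U_3), ... of the slice. The three
    metrics of the theorem all satisfy U_1 U_2 = 1, l_3 = 0 and the first-order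
    system: U_1' + U_1 M_1 = U_2' + U_2 M_2 = 0 and
    U_3' + U_3 M_3 = kappa := 2 l_1 l_2 / (l_1 + l_2). The connection is thus
    independent of t, and a spinor psi on G extended constantly in t is
    parallel as soon as e_1 psi = e_2 psi = 0 and
    e_3 psi + (kappa / 2) cl_3 psi = 0. Since
    Ric = diag ((l_1^2 - l_2^2) / 2, (l_2^2 - l_1^2) / 2, - (l_1 - l_2)^2 / 2)
    on G, these are precisely the equations of a Ricci Killing spinor with
    constant mu = - 1 / (2 (l_1 + l_2)); for l_2 = 0 they are solved by the
    invariant spinors. At the hypersurface all U_i are 1, and there the system
    says - U_i' = M_i - kappa_i = 2 mu Ric_i, which is the formula for the
    Weingarten tensor.

    The system is recorded for a general parameter s in the record profile:
    A_i = U_i^2, A_0 = (dt/ds)^2 and rho = U_3 ds/dt. From it the connection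
    coefficients and the Ricci tensor are computed explicitly
    (levi_civitaZ, ricci_flatZ, self_dual_connection_form, weingartenZ), which
    gives profile_extension. Case (i) is heis_profile; cases (ii) and (iii) are
    one computation, trig_profile, with U_1^2 proportional to a solution of
    T' = 1 - eps T^2, namely tanh or coth for eps = 1 and tan for eps = -1.

    The frame on Z has the brackets of the frame on G because d/ds commutes
    with left-invariant fields. In a chart this is the symmetry of second
    derivatives, derive_comm. *)

Set Implicit Arguments.
Unset Strict Implicit.
Unset Printing Implicit Defensive.

(** * Symmetry of second derivatives *)

Lemma distr_split (R : realFieldType) (p q m e : R) :
  `|p - m| < e / 2 -> `|q - m| < e / 2 -> `|p - q| <= e.
Proof.
move=> pm qm; rewrite -(subrKA m) (le_trans (ler_normD _ _))// (splitr e).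
by rewrite lerD ?ltW// distrC.
Qed.

Section MixedPartials.
Variables (R : realType) (V : normedModType R).
Implicit Types (f : V -> R^o) (x u v : V).

Lemma derive_line (W : normedModType R) (f : V -> W) x v (t : R) :
  'D_1 (fun s : R => f (x + s *: v)) t = 'D_v f (x + t *: v).
Proof.
rewrite /derive; set F := (X in lim (X @ _)); set H := (X in _ = lim (X @ _)).
suff -> : F = H by [].
by apply/funext => h; rewrite /F /H /= [h *: (1 : R)]mulr1 scalerDl addrCA.
Qed.

Lemma differentiable_line (W : normedModType R) (f : V -> W) x v (t : R) :
  differentiable f (x + t *: v) ->
  differentiable (fun s : R => f (x + s *: v)) t.
Proof.
move=> df; have dl : differentiable (fun s : R => x + s *: v) t.
  by apply: differentiableD; [exact: differentiable_cst|exact: differentiableZl].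
exact: (differentiable_comp dl df).
Qed.

Lemma is_derive_line f x v (t : R) : differentiable f (x + t *: v) ->
  is_derive t 1 (fun s : R => f (x + s *: v)) ('D_v f (x + t *: v)).
Proof.
move=> df; apply: DeriveDef; last exact: derive_line.
exact/diff_derivable/differentiable_line.
Qed.

(** The mean value theorem, applied to s |-> f (x + h v + s u) - f (x + s u)
    on [0, h] and then to the derivative of f along u. *)
Lemma second_difference f x u v (h : R) : 0 < h ->
  (forall a b, 0 <= a <= h -> 0 <= b <= h ->
    differentiable f (x + a *: u + b *: v) /\
    differentiable ('D_u f : V -> R^o) (x + a *: u + b *: v)) ->
  exists a b, [/\ 0 <= a <= h, 0 <= b <= h &
    f (x + h *: u + h *: v) - f (x + h *: u) - (f (x + h *: v) - f x) =
    'D_v ('D_u f) (x + a *: u + b *: v) * h * h].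
Proof.
move=> h0 df.
have hh : 0 <= h <= h by rewrite lexx ltW.
have h00 : 0 <= (0 : R) <= h by rewrite lexx ltW.
pose phi (s : R) : R^o := f (x + h *: v + s *: u) - f (x + s *: u).
pose dphi (s : R) : R := 'D_u f (x + h *: v + s *: u) - 'D_u f (x + s *: u).
have dphiP (s : R) : 0 <= s <= h -> is_derive s 1 phi (dphi s).
  move=> sh; apply: is_deriveB.
  - by apply: is_derive_line; rewrite addrAC; case: (df s h).
  - by apply: is_derive_line; case: (df s 0) => //; rewrite scale0r addr0.
have [a ah eqa] : exists2 c, c \in `]0, h[%R & phi h - phi 0 = dphi c * (h - 0).
  apply: (@MVT _ phi dphi 0 h h0) => [s /[!in_itv]/= /andP[s0 sh]|].
    by apply: dphiP; rewrite !ltW.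
  apply: continuous_in_subspaceT => s; rewrite inE/= in_itv/= => sh.
  by apply/differentiable_continuous/derivable1_diffP; case: (dphiP s sh).
have {}ah : 0 <= a <= h by move: ah; rewrite in_itv/= => /andP[]; move=> /ltW-> /ltW->.
pose psi (s : R) : R^o := 'D_u f (x + a *: u + s *: v).
pose dpsi (s : R) : R := 'D_v ('D_u f) (x + a *: u + s *: v).
have psiP (s : R) : 0 <= s <= h -> is_derive s 1 psi (dpsi s).
  by move=> sh; apply: is_derive_line; case: (df a s).
have [b bh eqb] : exists2 c, c \in `]0, h[%R & psi h - psi 0 = dpsi c * (h - 0).
  apply: (@MVT _ psi dpsi 0 h h0) => [s /[!in_itv]/= /andP[s0 sh]|].
    by apply: psiP; rewrite !ltW.
  apply: continuous_in_subspaceT => s; rewrite inE/= in_itv/= => sh.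
  by apply/differentiable_continuous/derivable1_diffP; case: (psiP s sh).
have {}bh : 0 <= b <= h by move: bh; rewrite in_itv/= => /andP[]; move=> /ltW-> /ltW->.
exists a, b; split => //.
move: eqa; rewrite /phi /dphi scale0r !addr0 !subr0 => eqa.
rewrite [x + h *: u + _]addrAC eqa; congr (_ * _).
move: eqb; rewrite /psi /dpsi scale0r addr0 subr0 => <-.
by rewrite (addrAC x (a *: u)).
Qed.

(** The second difference over a parallelogram of sides h u and h v is symmetric
    in u and v; divided by h^2 it is a value near x of either mixed derivative,
    and both are continuous at x. *)
Lemma derive_comm f (U : set V) x u v : open U -> U x ->
  (forall y, U y -> differentiable f y) ->
  (forall y, U y -> differentiable ('D_u f : V -> R^o) y) ->
  (forall y, U y -> differentiable ('D_v f : V -> R^o) y) ->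
  {for x, continuous ('D_v ('D_u f) : V -> R^o)} ->
  {for x, continuous ('D_u ('D_v f) : V -> R^o)} ->
  'D_v ('D_u f) x = 'D_u ('D_v f) x.
Proof.
move=> oU Ux df duf dvf cvu cuv.
apply/eqP; rewrite -subr_eq0 -normr_eq0 eq_le normr_ge0 andbT.
apply/ler_addgt0Pr => e e0; rewrite add0r.
have e20 : 0 < e / 2 by rewrite divr_gt0.
have H1 : \forall y \near x, U y by exact: open_nbhs_nbhs.
have H2 : \forall y \near x, `|('D_v ('D_u f) x : R^o) - 'D_v ('D_u f) y| < e / 2.
  by move/cvgrPdist_lt : cvu => /(_ _ e20).
have H3 : \forall y \near x, `|('D_u ('D_v f) x : R^o) - 'D_u ('D_v f) y| < e / 2.
  by move/cvgrPdist_lt : cuv => /(_ _ e20).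
have [d /= d0 xdP] := iffLR (nbhs_ballP _ _) (filterI H1 (filterI H2 H3)).
have N0 : 0 < `|u| + `|v| + 1 by rewrite ltr_wpDl// addr_ge0.
(* For a, b <= h the point x + a u + b v stays in the ball of radius d. *)
pose h := d / (`|u| + `|v| + 1) / 2.
have h0 : 0 < h by rewrite !divr_gt0.
have ballP (a b : R) : 0 <= a <= h -> 0 <= b <= h ->
    ball x d (x + a *: u + b *: v).
  move=> /andP[a0 ah] /andP[b0 bh].
  rewrite -ball_normE /ball_/= opprD addrA opprD addrA subrr sub0r.
  rewrite -opprD normrN (le_lt_trans (ler_normD _ _))// !normrZ !ger0_norm//.
  apply: (@le_lt_trans _ _ (h * (`|u| + `|v| + 1))).
    rewrite mulrDr mulr1 mulrDr ler_wpDr ?(ltW h0)// lerD// ler_wpM2r//.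
  by rewrite /h mulrAC mulfVK ?gt_eqF// ltr_pdivrMr// mulr_natr mulr2n ltrDl.
have [a [b [ah bh E1]]] : exists a b, [/\ 0 <= a <= h, 0 <= b <= h &
    f (x + h *: u + h *: v) - f (x + h *: u) - (f (x + h *: v) - f x) =
    'D_v ('D_u f) (x + a *: u + b *: v) * h * h].
  apply: second_difference => // a b ah bh.
  by have [Uy _] := xdP _ (ballP _ _ ah bh); split; auto.
have [a' [b' [ah' bh' E2]]] : exists a b, [/\ 0 <= a <= h, 0 <= b <= h &
    f (x + h *: u + h *: v) - f (x + h *: v) - (f (x + h *: u) - f x) =
    'D_u ('D_v f) (x + a *: v + b *: u) * h * h].
  rewrite [x + h *: u + _]addrAC; apply: second_difference => // a' b' ah' bh'; rewrite [_ + b' *: u]addrAC.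
  by have [Uy _] := xdP _ (ballP _ _ bh' ah'); split; auto.
have E : 'D_v ('D_u f) (x + a *: u + b *: v) =
         'D_u ('D_v f) (x + a' *: v + b' *: u).
  have sym (p q r s : R^o) : p - q - (r - s) = p - r - (q - s).
    by rewrite !opprB -!addrA; congr (p + _); rewrite addrCA [RHS]addrCA [- q - r]addrC.
  apply: (mulIf (lt0r_neq0 h0)); apply: (mulIf (lt0r_neq0 h0)).
  by apply: etrans (esym E1) _; apply: etrans E2; exact: sym.
have [_ [dvu_lt _]] := xdP _ (ballP _ _ ah bh).
have [_ [_ duv_lt]] := xdP _ (ballP _ _ bh' ah').
rewrite [x + b' *: u + _]addrAC -E in duv_lt.
exact: distr_split dvu_lt duv_lt.
Qed.

End MixedPartials.
(** * Smooth functions on a product *)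

Section Slices.
Variables (R : realType) (V1 V2 W : normedModType R).

Lemma derive_slicer (f : V1 * V2 -> W) (s : V1) (w v : V2) :
  'D_v (fun w => f (s, w)) w = 'D_(0, v) f (s, w).
Proof.
rewrite /derive; set F := (X in lim (X @ _)); set H := (X in _ = lim (X @ _)).
suff -> : F = H by [].
apply/funext => h; rewrite /F /H /=; congr (_ *: (f _ - _)).
by congr pair; rewrite /= scaler0 add0r.
Qed.

Lemma derive_slicel (f : V1 * V2 -> W) (s v : V1) (w : V2) :
  'D_v (fun s => f (s, w)) s = 'D_(v, 0) f (s, w).
Proof.
rewrite /derive; set F := (X in lim (X @ _)); set H := (X in _ = lim (X @ _)).
suff -> : F = H by [].
apply/funext => h; rewrite /F /H /=; congr (_ *: (f _ - _)).
by congr pair; rewrite /= scaler0 add0r.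
Qed.

Lemma differentiable_slice (f : V1 * V2 -> W) (s : V1) (w : V2) :
  differentiable f (s, w) -> differentiable (fun w => f (s, w)) w.
Proof.
move=> df; have dp : differentiable (fun w : V2 => (s, w)) w.
  by apply: differentiable_pair; [exact: differentiable_cst|].
exact: (differentiable_comp dp df).
Qed.

Lemma differentiable_snd (g : V2 -> W) (u : V1 * V2) :
  differentiable g u.2 -> differentiable (fun u : V1 * V2 => g u.2) u.
Proof.
move=> dg; have ds : differentiable (snd : V1 * V2 -> V2) u.
  by apply: (linear_differentiable (f := snd)) => x; exact: cvg_snd.
exact: (differentiable_comp ds dg).
Qed.

End Slices.

Lemma Ck_cst (R : realType) (V W : normedModType R) k (U : set V) (w : W) :
  Ck k U (fun=> w).
Proof.
elim: k w => [|k IH] w /=; first by move=> *; exact: cst_continuous.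
split=> [u _|v]; first exact: differentiable_cst.
by rewrite (_ : (fun u => 'D_v (fun=> w) u) = fun=> 0) //; apply/funext => u;
  exact: derive_cst.
Qed.

Section SmoothSlices.
Variables (R : realType) (V1 V2 W : normedModType R).

Lemma Ck_slice k (J : set V1) (U : set V2) (f : V1 * V2 -> W) (s : V1) :
  J s -> Ck k (J `*` U) f -> Ck k U (fun w => f (s, w)).
Proof.
move=> Js; elim: k f => [|k IH] f /=.
  move=> cf w Uw; apply: (@continuous_comp _ _ _ (fun w : V2 => (s, w)) f).
    apply: differentiable_continuous.
    by apply: differentiable_pair; [exact: differentiable_cst|].
  by apply: cf.
move=> [df dvf]; split=> [w Uw|v]; first by apply: differentiable_slice; exact: df.
have -> : (fun w => 'D_v (fun w0 => f (s, w0)) w) =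
          (fun w => 'D_(0, v) f (s, w)).
  by apply/funext => w; exact: derive_slicer.
exact: (IH (fun u => 'D_(0, v) f u)).
Qed.

Lemma Ck_snd k (J : set V1) (U : set V2) (g : V2 -> W) :
  Ck k U g -> Ck k (J `*` U) (fun u => g u.2).
Proof.
elim: k g => [|k IH] g /=.
  move=> cg u [_ Uu]; apply: (@continuous_comp _ _ _ snd g); first exact: cvg_snd.
  exact: cg.
move=> [dg dvg]; split=> [u [_ Uu]|v]; last exact: (IH (fun w => 'D_v.2 g w)).
by apply: differentiable_snd; exact: dg.
Qed.

End SmoothSlices.

(** * Left-invariant fields in charts *)

Section LeftFields.
Variables (R : realType) (n : nat) (G : lieGroup R n).
Implicit Types (y : R -> G) (x : G) (c : chart R n G).

(** The coordinates at x of the left-invariant field given by y. *)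
Definition chart_velocity y c x : 'rV[R]_n :=
  'D_1 (fun t : R => fwd c (lg_mul x (y t))) (0 : R).

Lemma lg_mulx1 x : lg_mul x (lg_one G) = x.
Proof.
have mulxV z : lg_mul z (lg_inv z) = lg_one G.
  rewrite -[LHS]lg_mul1 -{1}(lg_mulV (lg_inv z)) -lg_mulA.
  by rewrite (lg_mulA (lg_inv z)) lg_mulV lg_mul1 lg_mulV.
by rewrite -(lg_mulV x) lg_mulA mulxV lg_mul1.
Qed.

Lemma near_left_curve y x c : smooth_curve y -> y 0 = lg_one G -> dom c x ->
  \forall t \near (0 : R), dom c (lg_mul x (y t)).
Proof.
move=> [cy _] y0 cx.
have lc : {for (0 : R), continuous (fun t : R => lg_mul x (y t))}.
  apply: (@continuous_comp _ _ _ (fun t => (x, y t)) (fun xy => lg_mul xy.1 xy.2)).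
    by apply: cvg_pair => /=; [exact: cvg_cst|exact: cy].
  exact: lg_mul_continuous.
apply: lc; apply: open_nbhs_nbhs; split; first exact: dom_open.
by rewrite y0 lg_mulx1.
Qed.

(** In charts the curve t |-> x y(t) is the group multiplication, which is
    differentiable, after the curve y. *)
Lemma differentiable_left_curve y x c : smooth_curve y -> y 0 = lg_one G ->
  atlas c -> dom c x ->
  differentiable (fun t : R => fwd c (lg_mul x (y t))) (0 : R).
Proof.
move=> smy y0 Ac cx; have [cy sy] := smy.
have [d Ad d1] := atlas_cover (lg_one G).
have near_d : \forall t \near (0 : R), dom d (y t).
  by apply: cy; apply: open_nbhs_nbhs; split; [exact: dom_open|rewrite y0].
pose m (u : 'rV[R]_n * 'rV[R]_n) := fwd c (lg_mul (bwd c u.1) (bwd d u.2)).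
pose w := fwd c x.
have dm : differentiable m (w, fwd d (y 0)).
  have [dm _] := lg_mul_smooth Ac Ad Ac 1.
  apply: dm; split => /=.
  - by exists x.
  - by exists (y 0); rewrite // y0.
  - by rewrite !fwdK ?y0 // lg_mulx1.
have dy : differentiable (fun t : R => fwd d (y t)) (0 : R).
  by have [dy _] := sy d Ad 1; apply: dy; rewrite /preimage/= y0.
have dwy : differentiable (fun t : R => (w, fwd d (y t))) (0 : R).
  by apply: differentiable_pair; [exact: differentiable_cst|exact: dy].
have dc := differentiable_comp dwy dm.
apply/derivable1_diffP; apply: near_eq_derivable (iffRL (derivable1_diffP _ _) dc).
by near=> t; rewrite /m /= !fwdK //; near: t.
Unshelve. all: by end_near. Qed.

(** Chain rule: in a chart a left-invariant field is a directional derivative,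
    along a vector that is the same for all functions. *)
Lemma left_fieldE y f x c : smooth_curve y -> y 0 = lg_one G ->
  atlas c -> dom c x -> differentiable (f \o bwd c : _ -> R^o) (fwd c x) ->
  left_field y f x = 'D_(chart_velocity y c x) (f \o bwd c : _ -> R^o) (fwd c x).
Proof.
move=> smy y0 Ac cx df.
pose u (t : R) : 'rV[R]_n := fwd c (lg_mul x (y t)).
have du : differentiable u (0 : R) by exact: differentiable_left_curve.
have u0 : u 0 = fwd c x by rewrite /u y0 lg_mulx1.
have df' : differentiable (f \o bwd c : _ -> R^o) (u 0) by rewrite u0.
rewrite /left_field derive1E.
have -> : 'D_1 (fun t => f (lg_mul x (y t))) 0 = 'D_1 ((f \o bwd c : _ -> R^o) \o u) 0.
  apply: near_eq_derive.
  by near=> t; rewrite /u /= fwdK //; near: t; exact: near_left_curve.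
rewrite deriveE; last exact: differentiable_comp.
by rewrite diff_comp //= -(deriveE _ du) -(deriveE _ df') u0.
Unshelve. all: by end_near. Qed.

End LeftFields.

Section Cylinder.
Variables (R : realType) (G : lieGroup R 3) (J : set R).

(** In a chart both sides are second derivatives of F along (1, 0) and a fixed
    vector (0, v). *)
Lemma left_field_derive_comm (y : R -> G) (F : R * G -> R) (s : R) (x : G) :
  open J -> J s -> smooth_funZ J F -> smooth_curve y -> y 0 = lg_one G ->
  derive1 (fun s => left_field y (fun x => F (s, x)) x) s =
  left_field y (fun x => derive1 (fun s => F (s, x)) s) x.
Proof.
move=> oJ Js sF smy y0.
have [c Ac cx] := atlas_cover x.
pose Fc : R^o * 'rV[R]_3 -> R^o := fun u => F (u.1, bwd c u.2).
pose v := chart_velocity y c x.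
pose w := fwd c x.
have wc : img c w by exists x.
have smF : smooth_on ((J : set R^o) `*` img c) Fc by exact: sF.
have [dF dvF] := smF 2.
have oU : open ((J : set R^o) `*` img c).
  apply: openI; first by apply: open_comp => // u _; exact: cvg_fst.
  by apply: open_comp; [move=> u _; exact: cvg_snd|exact: img_open].
pose D1 : R^o * 'rV[R]_3 -> R^o := fun u => 'D_((1 : R^o), 0) Fc u.
pose Dv : R^o * 'rV[R]_3 -> R^o := fun u => 'D_((0 : R^o), v) Fc u.
have [dD1 dD1v] : Ck 1 ((J : set R^o) `*` img c) D1 := dvF (1, 0).
have [dDv dDv1] : Ck 1 ((J : set R^o) `*` img c) Dv := dvF (0, v).
have lhs : derive1 (fun s => left_field y (fun x => F (s, x)) x) s =
    'D_(1, 0) Dv (s : R^o, w).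
  rewrite derive1E -derive_slicel; apply: near_eq_derive.
  near=> r; have Jr : J r by near: r; exact: open_nbhs_nbhs.
  have dFr : differentiable (fun w => Fc (r : R^o, w)) w.
    by apply: differentiable_slice; exact: dF.
  by rewrite (left_fieldE smy y0 Ac cx dFr) /Dv -derive_slicer.
have rhs : left_field y (fun x => derive1 (fun s => F (s, x)) s) x =
    'D_(0, v) D1 (s : R^o, w).
  have E : (fun x => derive1 (fun s => F (s, x)) s : R^o) \o bwd c =
           (fun w => D1 (s : R^o, w)).
    by apply/funext => z; rewrite /= derive1E /D1 -derive_slicel.
  have dE : differentiable (fun w => D1 (s : R^o, w)) w.
    exact: (differentiable_slice (dD1 (s, w) (conj Js wc))).
  rewrite -E in dE.
  apply: etrans (left_fieldE smy y0 Ac cx dE) _.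
  by rewrite E; exact: derive_slicer.
apply: etrans lhs _; apply: etrans _ (esym rhs).
have Usw : ((J : set R^o) `*` img c) (s : R^o, w) by split.
exact: (@derive_comm _ _ Fc _ (s : R^o, w) (0, v) (1, 0) oU Usw
          dF dDv dD1 (dDv1 _ _ Usw) (dD1v _ _ Usw)).
Unshelve. all: by end_near. Qed.

End Cylinder.

(** * Frame indices *)

Local Notation i0 := (@Ordinal 3 0 isT).
Local Notation i1 := (@Ordinal 3 1 isT).
Local Notation i2 := (@Ordinal 3 2 isT).
(* The index of d/ds; rshift 1 i is that of e_i. *)
Local Notation z0 := (lshift 3 ord0 : 'I_(1 + 3)).

Lemma ord3P (P : 'I_3 -> Prop) : P i0 -> P i1 -> P i2 -> forall i, P i.
Proof.
move=> P0 P1 P2 [[|[|[|]]]] //= lt.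
- by rewrite (_ : Ordinal lt = i0) //; apply: val_inj.
- by rewrite (_ : Ordinal lt = i1) //; apply: val_inj.
- by rewrite (_ : Ordinal lt = i2) //; apply: val_inj.
Qed.

Lemma ord1_3P (P : 'I_(1 + 3) -> Prop) :
  P z0 -> (forall i, P (rshift 1 i)) -> forall a, P a.
Proof.
move=> P0 P1 a; rewrite -(splitK a); case: (fintype.split a) => i; last exact: P1.
by rewrite ord1.
Qed.

Lemma ord13P (P : 'I_(1 + 3) -> Prop) : P z0 -> P (rshift 1 i0) ->
  P (rshift 1 i1) -> P (rshift 1 i2) -> forall a, P a.
Proof. by move=> P0 P1 P2 P3; apply: ord1_3P => //; apply: ord3P. Qed.

Lemma sum3E (V : nmodType) (F : 'I_3 -> V) : \sum_i F i = F i0 + F i1 + F i2.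
Proof.
rewrite !big_ord_recl big_ord0 addr0 addrA.
by congr (F _ + F _ + F _); apply: val_inj.
Qed.

Lemma sum13E (V : nmodType) (F : 'I_(1 + 3) -> V) :
  \sum_a F a = F z0 + F (rshift 1 i0) + F (rshift 1 i1) + F (rshift 1 i2).
Proof. by rewrite big_split_ord /= big_ord1 sum3E !addrA. Qed.

Lemma val_z0 : nat_of_ord z0 = 0%N. Proof. by []. Qed.

Lemma val_rshift1 (i : 'I_3) : nat_of_ord (rshift 1 i) = i.+1. Proof. by []. Qed.

Lemma split_z0 : fintype.split z0 = inl ord0.
Proof. exact: (unsplitK (inl ord0)). Qed.

Lemma split_rshift1 (i : 'I_3) : fintype.split (rshift 1 i : 'I_(1 + 3)) = inr i.
Proof. exact: (unsplitK (inr i)). Qed.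

(** * Curvature in a frame *)

Section ConstantFrame.
Variables (R : realType) (M : Type) (n : nat).
Variable E : 'I_n -> (M -> R) -> M -> R.
Hypothesis E_cst : forall a (k : R) q, E a (fun=> k) q = 0.
Implicit Types (c Gam : 'I_n -> 'I_n -> 'I_n -> M -> R).

Lemma sum_delta_row (d : 'I_n) (F : 'I_n -> R) :
  \sum_b (delta_mx 0 d : 'rV[R]_n) 0 b * F b = F d.
Proof.
rewrite (bigD1 d) //= mxE !eqxx mul1r big1 ?addr0 // => b bd.
by rewrite mxE eqxx /= (negbTE bd) mul0r.
Qed.

Lemma nabla_delta Gam b d q :
  nabla E Gam b (fun=> delta_mx 0 d) q = \row_k Gam b d k q.
Proof. by apply/rowP => k; rewrite !mxE sum_delta_row E_cst add0r. Qed.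

(** The frame fields have constant components in the frame, so that their
    covariant derivatives are the connection coefficients. *)
Lemma ricciE c Gam b d p : ricci E c Gam b d p =
  \sum_a (E a (Gam b d a) p - E b (Gam a d a) p
          + \sum_m (Gam b d m p * Gam a m a p - Gam a d m p * Gam b m a p)
          - \sum_k c a b k p * Gam k d a p).
Proof.
apply: eq_bigr => a _; rewrite /curvature.
have nD a' : nabla E Gam a' (fun=> delta_mx 0 d) = fun q => \row_k Gam a' d k q.
  by apply/funext => q; exact: nabla_delta.
have nnD a' b' : nabla E Gam a' (nabla E Gam b' (fun=> delta_mx 0 d)) p 0 a =
    E a' (Gam b' d a) p + \sum_m Gam b' d m p * Gam a' m a p.
  rewrite nD mxE; congr (E _ _ _ + _).
    by apply/funext => q; rewrite mxE.
  by apply: eq_bigr => m _; rewrite mxE.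
have sub3 (u v w : 'rV[R]_n) : (u - v - w) 0 a = u 0 a - v 0 a - w 0 a.
  by rewrite !mxE.
rewrite sub3 !nnD summxE sumrB.
have -> : \sum_k (c a b k p *: nabla E Gam k (fun=> delta_mx 0 d) p) 0 a =
    \sum_k c a b k p * Gam k d a p.
  by apply: eq_bigr => k _; rewrite mxE nD mxE.
by congr (_ - _); rewrite opprD !addrA; congr (_ - _); rewrite addrAC.
Qed.

End ConstantFrame.

(** * The Levi-Civita connection of a Milnor frame *)

Section MilnorConnection.
Variables (R : realType) (G : lieGroup R 3) (e : 'I_3 -> R -> G).

Lemma frame_cst i (k : R) x : frame e i (fun=> k) x = 0.
Proof. exact: derive1_cst. Qed.

(** Koszul formula for an orthonormal left-invariant frame. *)
Lemma levi_civita_gramE c Gam :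
  levi_civita setT (frame e) (lift_const c) (@gram R G) Gam ->
  forall a b k x, Gam a b k x = (c a b k - c b k a + c k a b) / 2.
Proof.
move=> lc a b k x; have [T M] := lc x I.
have Msum a' b' d' : Gam a' b' d' x + Gam a' d' b' x = 0.
  have := M a' b' d'; rewrite /gram frame_cst big_split /=.
  rewrite (bigD1 d') //= eqxx mulr1 big1 ?addr0; last first.
    by move=> i /negbTE ->; rewrite mulr0.
  rewrite (bigD1 b') //= eqxx mulr1 big1 ?addr0 //.
  by move=> i; rewrite eq_sym => /negbTE ->; rewrite mulr0.
move: (T a b k) (T b k a) (T k a b); rewrite /lift_const => <- <- <-.
by move: (Msum a b k) (Msum b k a) (Msum k a b); lra.
Qed.

(** The structure constants for l3 = 0, indexed by natural numbers so that they
    reduce on numerals. *)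
Definition milnor_table (l1 l2 : R) (i j k : nat) : R :=
  match i, j, k with
  | 1%N, 2%N, 0%N => l1 | 2%N, 1%N, 0%N => - l1
  | 2%N, 0%N, 1%N => l2 | 0%N, 2%N, 1%N => - l2
  | _, _, _ => 0
  end.

Lemma milnor_constE l1 l2 (i j k : 'I_3) :
  milnor_const l1 l2 0 i j k = milnor_table l1 l2 i j k.
Proof.
by move: i j k; do 3![apply: ord3P]; rewrite /milnor_const /triple /= ?oppr0.
Qed.

Lemma ricci_milnor l1 l2 Gam :
  levi_civita setT (frame e) (lift_const (milnor_const l1 l2 0)) (@gram R G) Gam ->
  forall i j x, ricci (frame e) (lift_const (milnor_const l1 l2 0)) Gam i j x =
   (i == j)%:R * triple ((l1 ^+ 2 - l2 ^+ 2) / 2) ((l2 ^+ 2 - l1 ^+ 2) / 2)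
                        (- (l1 - l2) ^+ 2 / 2) i.
Proof.
move=> lc i j x; rewrite ricciE; last exact: frame_cst.
have GE a b k : Gam a b k = fun=> let c := milnor_table l1 l2 in
     (c a b k - c b k a + c k a b) / 2.
  by apply/funext => y; rewrite (levi_civita_gramE lc) !milnor_constE.
rewrite sum3E !GE !frame_cst !sum3E /lift_const !GE !milnor_constE /triple.
move: i j; do 2![apply: ord3P] => /=.
all: by field.
Qed.

End MilnorConnection.

(** * Spin representations in dimensions 3 and 4 *)

Section ColumnEntries.
Variables (K : pzRingType) (n : nat).
Implicit Types u v : 'cV[K]_n.

Lemma col0E k : (0 : 'cV[K]_n) k 0 = 0. Proof. by rewrite mxE. Qed.
Lemma colDE u v k : (u + v) k 0 = u k 0 + v k 0. Proof. by rewrite mxE. Qed.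
Lemma colNE u k : (- u) k 0 = - u k 0. Proof. by rewrite mxE. Qed.
Lemma colZE (a : K) u k : (a *: u) k 0 = a * u k 0. Proof. by rewrite mxE. Qed.

End ColumnEntries.

Section Clifford.
Variables (R : realType) (cl : 'I_3 -> 'M[R[i]]_2).
Hypothesis cl3 : clifford3 cl.
Local Open Scope complex_scope.

Lemma clifford3_sqr i : cl i *m cl i = - 1%:M.
Proof.
have [clE _] := cl3.
have two0 : (2 : R[i]) != 0 by rewrite pnatr_eq0.
apply: (scalerI two0); rewrite scaler_nat mulr2n clE eqxx mulr1.
by rewrite scalerN scalemx1 raddfN.
Qed.

Lemma clifford3_anti i j : i != j -> cl j *m cl i = - (cl i *m cl j).
Proof.
have [clE _] := cl3 => /negbTE ij.
by apply/eqP; rewrite -addr_eq0 addrC clE ij mulr0 raddf0.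
Qed.

Lemma clifford3_01 : cl i0 *m cl i1 = cl i2.
Proof.
have [_ E] := cl3.
have [<- <- <-] : [/\ 0 = i0, 1 = i1 & 2 = i2 :> 'I_3] by split; apply: val_inj.
exact: E.
Qed.

Lemma clifford3_12 : cl i1 *m cl i2 = cl i0.
Proof.
rewrite -clifford3_01 mulmxA (@clifford3_anti i0 i1) // mulNmx -mulmxA.
by rewrite clifford3_sqr mulmxN mulmx1 opprK.
Qed.

Lemma clifford3_20 : cl i2 *m cl i0 = cl i1.
Proof.
rewrite -clifford3_01 -mulmxA (@clifford3_anti i0 i1) // mulmxN mulmxA.
by rewrite clifford3_sqr mulNmx mul1mx opprK.
Qed.

(** Clifford multiplication by the volume element is - 1, so that the
    product of two different generators is, up to sign, the third one; the
    squares have coefficient w b b = 0. *)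
Lemma spin3_action (w : 'I_3 -> 'I_3 -> R) (v : 'cV[R[i]]_2) :
  (forall b d, w d b = - w b d) ->
  4^-1 *: (\sum_b \sum_d (w b d)%:C *: (cl b *m cl d *m v)) =
  2^-1 *: ((w i1 i2)%:C *: (cl i0 *m v) + (w i2 i0)%:C *: (cl i1 *m v)
           + (w i0 i1)%:C *: (cl i2 *m v)).
Proof.
move=> wN; have w0 b : (w b b)%:C *: (cl b *m cl b *m v) = 0.
  by rewrite (_ : w b b = 0) ?scale0r //; have := wN b b; lra.
under eq_bigr => b _ do rewrite sum3E.
rewrite sum3E.
rewrite (w0 i0) (w0 i1) (w0 i2).
rewrite (wN i0 i1).
rewrite (wN i2 i0).
rewrite (wN i1 i2).
rewrite (@clifford3_anti i0 i1) // (@clifford3_anti i1 i2) //.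
rewrite (@clifford3_anti i2 i0) // clifford3_01 clifford3_12 clifford3_20.
rewrite !(mulNmx, raddfN, scaleNr, scalerN, opprK) /=.
move: (cl i0 *m v) (cl i1 *m v) (cl i2 *m v) => u0 u1 u2.
apply/colP => k.
rewrite !(colDE, colNE, colZE, col0E).
by field.
Qed.

(** Along e_i only the multiplication by e_i survives in the action of the
    connection form; this isolates that term. *)
Lemma half_combination1 (w : 'I_3 -> R) (u : 'I_3 -> 'cV[R[i]]_2) i :
  (forall j, j != i -> w j = 0) ->
  2^-1 *: ((w i0)%:C *: u i0 + (w i1)%:C *: u i1 + (w i2)%:C *: u i2) =
  (w i / 2)%:C *: u i.
Proof.
have z v : (0 : R)%:C *: v = 0 :> 'cV[R[i]]_2 by exact: scale0r.
have half k v : 2^-1 *: (k%:C *: v) = (k / 2)%:C *: v :> 'cV[R[i]]_2.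
  by rewrite scalerA mulrC rmorphM fmorphV rmorph_nat.
move: i; apply: ord3P => w0.
- by rewrite (w0 i1) // (w0 i2) // (z (u i1)) (z (u i2)) !addr0 half.
- by rewrite (w0 i0) // (w0 i2) // (z (u i0)) (z (u i2)) addr0 add0r half.
- by rewrite (w0 i0) // (w0 i1) // (z (u i0)) (z (u i1)) addr0 add0r half.
Qed.

Lemma clifford4_z0r i (v : 'cV[R[i]]_2) :
  clifford4 cl (rshift 1 i) *m clifford4 cl z0 *m col_mx v 0 =
  col_mx (- (cl i *m v)) 0.
Proof.
rewrite /clifford4 split_z0 split_rshift1 mulmx_block mul_block_col.
by rewrite !(mul0mx, mulmx0, mulmx1, mulNmx, addr0, add0r).
Qed.

Lemma clifford4_rr i j (v : 'cV[R[i]]_2) :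
  clifford4 cl (rshift 1 i) *m clifford4 cl (rshift 1 j) *m col_mx v 0 =
  col_mx (cl i *m cl j *m v) 0.
Proof.
rewrite /clifford4 !split_rshift1 mulmx_block mul_block_col.
by rewrite !(mul0mx, mulmx0, mulmxN, mulNmx, opprK, addr0, add0r).
Qed.

(** On positive half-spinors only the self-dual part of so(4) acts: there
    cl4_0 cl4_i and cl4_j cl4_k, for i, j, k cyclic, are both cl_i. *)
Lemma spin4_action (w : 'I_(1 + 3) -> 'I_(1 + 3) -> R) (v : 'cV[R[i]]_2) :
  (forall b d, w d b = - w b d) ->
  4^-1 *: (\sum_b \sum_d (w b d)%:C *:
             (clifford4 cl b *m clifford4 cl d *m col_mx v 0)) =
  col_mx (2^-1 *:
    ((w z0 (rshift 1 i0) + w (rshift 1 i1) (rshift 1 i2))%:C *: (cl i0 *m v) +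
     (w z0 (rshift 1 i1) + w (rshift 1 i2) (rshift 1 i0))%:C *: (cl i1 *m v) +
     (w z0 (rshift 1 i2) + w (rshift 1 i0) (rshift 1 i1))%:C *: (cl i2 *m v)))
    0.
Proof.
move=> wN; have w0 b : w b b = 0 by have := wN b b; lra.
have col0 (a b : 'cV[R[i]]_2) : col_mx a 0 + col_mx b 0 = col_mx (a + b) 0 :> 'cV[R[i]]_(2 + 2).
  by rewrite add_col_mx addr0.
have colZ k (a : 'cV[R[i]]_2) : k *: col_mx a 0 = col_mx (k *: a) 0 :> 'cV[R[i]]_(2 + 2).
  by rewrite scale_col_mx scaler0.
have sum_col (F : 'I_3 -> 'cV[R[i]]_2) :
    \sum_i col_mx (F i) 0 = col_mx (\sum_i F i) 0 :> 'cV[R[i]]_(2 + 2).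
  by rewrite !sum3E !col0.
rewrite big_split_ord /= big_ord1 big_split_ord /= big_ord1 w0 scale0r add0r.
under eq_bigr => i _ do rewrite clifford4_half colZ.
rewrite sum_col [X in _ + X](eq_bigr (fun i : 'I_3 => col_mx (
    (w z0 (rshift 1 i))%:C *: (cl i *m v) +
    \sum_(j < 3) (w (rshift 1 i) (rshift 1 j))%:C *: (cl i *m cl j *m v)) 0)); last first.
  move=> i _; rewrite big_split_ord /= big_ord1 clifford4_z0r colZ scalerN -scaleNr.
  rewrite -col0 -sum_col (wN z0) raddfN /= opprK; congr (_ + _).
  by apply: eq_bigr => j _; rewrite clifford4_rr colZ.
rewrite sum_col col0 colZ big_split /= addrA scalerDr.
rewrite (@spin3_action (fun i j => w (rshift 1 i) (rshift 1 j))) //.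
rewrite !sum3E; congr (col_mx _ _).
move: (cl i0 *m v) (cl i1 *m v) (cl i2 *m v) => u0 u1 u2.
rewrite !rmorphD /=.
apply/colP => k.
rewrite !(colDE, colNE, colZE).
by field.
Qed.

End Clifford.

(** * The frame and the diagonal metric on the cylinder *)

Section CylinderFrame.
Variables (R : realType) (G : lieGroup R 3) (e : 'I_3 -> R -> G) (J : set R).

Lemma frameZ_z0 F p : frameZ e z0 F p = derive1 (fun s => F (s, p.2)) p.1.
Proof. by rewrite /frameZ split_z0. Qed.

Lemma frameZ_rshift1 i F p :
  frameZ e (rshift 1 i) F p = frame e i (fun x => F (p.1, x)) p.2.
Proof. by rewrite /frameZ split_rshift1. Qed.

Lemma frameZ_cst a (k : R) q : frameZ e a (fun=> k) q = 0.
Proof.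
by rewrite /frameZ; case: (fintype.split a) => i; exact: derive1_cst.
Qed.

Lemma frameZ_fst i (phi : R -> R) p :
  frameZ e (rshift 1 i) (fun q => phi q.1) p = 0.
Proof. by rewrite frameZ_rshift1 /=; exact: frame_cst. Qed.

Definition lift_constZ (c : 'I_3 -> 'I_3 -> 'I_3 -> R) (a b k : 'I_(1 + 3))
    (_ : R * G) : R :=
  match fintype.split a, fintype.split b, fintype.split k with
  | inr i, inr j, inr l => c i j l
  | _, _, _ => 0
  end.

(** The brackets of the e_i are those of G on each slice, and d/ds commutes
    with the e_i. *)
Lemma frame_bracketsZ l1 l2 l3 : open J -> milnor_frame e l1 l2 l3 ->
  frame_brackets (domZ J) (frameZ e) (smooth_funZ J)
    (lift_constZ (milnor_const l1 l2 l3)).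
Proof.
move=> oJ [ecurve _ ebr] F smF a b [s x] [/= Js _].
have comm i : frameZ e z0 (frameZ e (rshift 1 i) F) (s, x) =
              frameZ e (rshift 1 i) (frameZ e z0 F) (s, x).
  rewrite frameZ_z0 frameZ_rshift1 /=.
  have [sme e1] := ecurve i.
  have := left_field_derive_comm x oJ Js smF sme e1.
  set A := derive1 _ _ => H; set B := derive1 _ _.
  have -> : B = A.
    by rewrite /A /B; congr derive1; apply/funext => r; rewrite frameZ_rshift1.
  rewrite H /frame; congr left_field; apply/funext => z.
  by rewrite frameZ_z0.
rewrite -(splitK a) -(splitK b).
case: (fintype.split a) => i; case: (fintype.split b) => j /=; rewrite ?ord1.
- rewrite subrr big1 // => k _.
  by rewrite /lift_constZ split_z0 mul0r.
- rewrite comm subrr big1 // => k _.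
  by rewrite /lift_constZ split_z0 mul0r.
- rewrite comm subrr big1 // => k _.
  by rewrite /lift_constZ split_z0; case: (fintype.split _) => *; rewrite mul0r.
rewrite big_split_ord /= big_ord1 {1}/lift_constZ !split_rshift1 split_z0.
rewrite mul0r add0r.
have smFs : smooth_fun (fun x => F (s, x)).
  by move=> c Ac k; exact: (Ck_slice (Js : (J : set R^o) s) (smF c Ac k)).
have := ebr _ smFs i j x I.
rewrite !frameZ_rshift1 /=.
have E l : (fun x0 => frameZ e (rshift 1 l) F (s, x0)) =
           frame e l (fun x1 => F (s, x1)).
  by apply/funext => z; rewrite frameZ_rshift1.
rewrite !E => ->; apply: eq_bigr => k _.
by rewrite /lift_constZ !split_rshift1 frameZ_rshift1.
Qed.

End CylinderFrame.

Section DiagonalMetric.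
Variables (R : realType) (G : lieGroup R 3).
Variables (A0 : R -> R) (A : 'I_3 -> R -> R) (sdot : R -> R).

Definition diagZ (a : 'I_(1 + 3)) (s : R) : R :=
  match fintype.split a with inl _ => A0 s | inr i => A i s end.

Definition normZ (a : 'I_(1 + 3)) (s : R) : R :=
  match fintype.split a with
  | inl _ => sdot s | inr i => (Num.sqrt (A i s))^-1
  end.

Lemma gramZE a b (p : R * G) : gramZ A0 A a b p = (a == b)%:R * diagZ a p.1.
Proof.
rewrite /gramZ mxE /diagZ -(splitK a) mulr_natl.
case: (fintype.split a) => i /=.
  by rewrite ord1 split_z0 row_mxEl mxE eqxx mulr1n.
by rewrite split_rshift1 row_mxEr mxE.
Qed.

Lemma orthoZE a (p : R * G) : orthoZ sdot A a p = normZ a p.1 *: delta_mx 0 a.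
Proof.
rewrite /orthoZ /normZ -(splitK a); case: (fintype.split a) => i /=.
  rewrite ord1 split_z0; apply/rowP => k; rewrite mxE [RHS]mxE.
  case: split_ordP => j ->; rewrite !mxE ?ord1 ?eqxx ?mulr1 //.
  by rewrite eq_rlshift mulr0.
rewrite split_rshift1; apply/rowP => k; rewrite mxE [RHS]mxE.
case: split_ordP => j ->; rewrite !mxE ?eqxx /=.
  by rewrite eq_lrshift mulr0.
by rewrite eq_rshift.
Qed.

Lemma inner_gramZ X Y (p : R * G) :
  inner (gramZ A0 A) X Y p = \sum_a X p 0 a * Y p 0 a * diagZ a p.1.
Proof.
apply: eq_bigr => a _; rewrite (bigD1 a) //= gramZE eqxx mul1r.
rewrite big1 ?addr0 // => b ba.
by rewrite gramZE eq_sym (negbTE ba) mul0r mulr0.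
Qed.

Lemma inner_orthoZ X d (p : R * G) : inner (gramZ A0 A) X (orthoZ sdot A d) p =
  X p 0 d * normZ d p.1 * diagZ d p.1.
Proof.
rewrite inner_gramZ (bigD1 d) //= orthoZE !mxE !eqxx mulr1 big1 ?addr0 //.
by move=> b bd; rewrite !mxE eqxx (negbTE bd) mulr0 mulr0 mul0r.
Qed.

Lemma nabla_orthoZ E (Gam : 'I_(1 + 3) -> 'I_(1 + 3) -> 'I_(1 + 3) -> R * G -> R) a b (p : R * G) k :
  (forall q, E a (fun=> (0 : R)) q = 0) ->
  nabla E Gam a (orthoZ sdot A b) p 0 k =
  (if b == k then E a (fun q => normZ b q.1) p else 0) + normZ b p.1 * Gam a b k p.
Proof.
move=> E0; rewrite mxE; congr (_ + _).
  case: eqP => [->|/eqP bk].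
    congr (E _ _ _); apply/funext => q.
    by rewrite orthoZE !mxE !eqxx mulr1.
  rewrite -[RHS](E0 p); congr (E _ _ _); apply/funext => q.
  by rewrite orthoZE !mxE eqxx eq_sym (negbTE bk) mulr0.
rewrite (bigD1 b) //= orthoZE !mxE !eqxx mulr1 big1 ?addr0 // => d db.
by rewrite !mxE eqxx (negbTE db) mulr0 mul0r.
Qed.

End DiagonalMetric.

(** * Rules of differentiation in one variable *)

Section Derivatives.
Variables (R : realType) (s : R).
Implicit Types f g : R -> R.

Lemma is_derive_cstf (k : R) : is_derive s 1 (fun=> k) 0.
Proof. exact: is_derive_cst. Qed.

Lemma is_derive_addf f g df dg : is_derive s 1 f df -> is_derive s 1 g dg ->
  is_derive s 1 (fun x => f x + g x) (df + dg).
Proof. exact: is_deriveD. Qed.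

Lemma is_derive_subf f g df dg : is_derive s 1 f df -> is_derive s 1 g dg ->
  is_derive s 1 (fun x => f x - g x) (df - dg).
Proof. exact: is_deriveB. Qed.

Lemma is_derive_oppf f df : is_derive s 1 f df ->
  is_derive s 1 (fun x => - f x) (- df).
Proof. exact: is_deriveN. Qed.

Lemma is_derive_mulf f g df dg : is_derive s 1 f df -> is_derive s 1 g dg ->
  is_derive s 1 (fun x => f x * g x) (df * g s + f s * dg).
Proof.
move=> df' dg'; apply: is_derive_eq (is_deriveM df' dg') _.
by rewrite /GRing.scale /=; ring.
Qed.

Lemma is_derive_invf f df : f s != 0 -> is_derive s 1 f df ->
  is_derive s 1 (fun x => (f x)^-1) (- df / f s ^+ 2).
Proof.
move=> f0 [dv <-]; apply: DeriveDef; first exact: derivableV.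
by rewrite deriveV //= /GRing.scale /= mulNr mulrC mulNr.
Qed.

Lemma is_derive_divf f g df dg : g s != 0 ->
  is_derive s 1 f df -> is_derive s 1 g dg ->
  is_derive s 1 (fun x => f x / g x) ((df * g s - f s * dg) / g s ^+ 2).
Proof.
move=> g0 df' dg'.
apply: is_derive_eq (is_derive_mulf df' (is_derive_invf g0 dg')) _.
by field.
Qed.

Lemma is_derive_comp f g df dg : is_derive (g s) 1 f df -> is_derive s 1 g dg ->
  is_derive s 1 (fun x => f (g x)) (df * dg).
Proof. exact: is_derive1_comp. Qed.

Lemma is_derive_sqrtf f df : 0 < f s -> is_derive s 1 f df ->
  is_derive s 1 (fun r => Num.sqrt (f r)) (df / (2 * Num.sqrt (f s))).
Proof.
move=> fs0 dfs; apply: is_derive_eq (is_derive_comp (is_derive1_sqrt fs0) dfs) _.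
by rewrite mulrC.
Qed.

End Derivatives.

(** * The first-order system *)

Section Profile.
Variables (R : realType) (J : set R) (l1 l2 kappa : R).
Variables (A0 A1 A2 A3 rho drho : R -> R).

(** For U_1 U_2 = 1 and l_3 = 0 these are - 2 U_3 M_1 = 2 U_3 M_2 and
    2 U_3 M_3. *)
Definition diff_lA s := l1 * A1 s - l2 * A2 s.
Definition sum_lA s := l1 * A1 s + l2 * A2 s.
(** The rates are the logarithmic derivatives in s of U_1 = 1 / U_2 and of U_3
    that the first-order system prescribes. *)
Definition rate1 s := diff_lA s / (2 * rho s).
Definition rate3 s := (kappa - sum_lA s / 2) / rho s.

(** The first-order system U_1' + U_1 M_1 = U_2' + U_2 M_2 = 0,
    U_3' + U_3 M_3 = kappa for A_i = U_i^2, in a parameter s with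
    A0 = (dt/ds)^2 and rho = U_3 ds/dt, under the normalization U_1 U_2 = 1. *)
Record profile : Prop := Profile {
  pr_open : open J;
  pr_A1_gt0 : forall s, J s -> 0 < A1 s;
  pr_A3_gt0 : forall s, J s -> 0 < A3 s;
  pr_rho_neq0 : forall s, J s -> rho s != 0;
  pr_A2 : forall s, J s -> A2 s = (A1 s)^-1;
  pr_A0 : forall s, J s -> A0 s = A3 s / rho s ^+ 2;
  pr_dA1 : forall s, J s -> is_derive s 1 A1 (2 * rate1 s * A1 s);
  pr_dA3 : forall s, J s -> is_derive s 1 A3 (2 * rate3 s * A3 s);
  pr_drho : forall s, J s -> is_derive s 1 rho (drho s) }.

(** The logarithmic derivative of dt/ds = U_3 / rho. *)
Definition rate0 s := rate3 s - drho s / rho s.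

(** The coefficients of the Koszul formula, simplified with A2 = 1 / A1 and
    A0 = A3 / rho^2; the index 0 is d/ds and k > 0 is e_k. *)
Definition christoffel (s : R) (a b k : nat) : R :=
  match a, b, k with
  | 0%N, 0%N, 0%N => rate0 s
  | 0%N, 1%N, 1%N | 1%N, 0%N, 1%N => rate1 s
  | 0%N, 2%N, 2%N | 2%N, 0%N, 2%N => - rate1 s
  | 0%N, 3%N, 3%N | 3%N, 0%N, 3%N => rate3 s
  | 1%N, 1%N, 0%N => - (diff_lA s * A1 s * rho s / (2 * A3 s))
  | 2%N, 2%N, 0%N => diff_lA s * A2 s * rho s / (2 * A3 s)
  | 3%N, 3%N, 0%N => - ((kappa - sum_lA s / 2) * rho s)
  | 1%N, 2%N, 3%N | 2%N, 1%N, 3%N => - (diff_lA s / (2 * A3 s))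
  | 1%N, 3%N, 2%N => diff_lA s * A1 s / 2
  | 3%N, 1%N, 2%N => sum_lA s * A1 s / 2
  | 2%N, 3%N, 1%N => diff_lA s * A2 s / 2
  | 3%N, 2%N, 1%N => - (sum_lA s * A2 s / 2)
  | _, _, _ => 0
  end.

Hypothesis pr : profile.

Lemma near_profile (P : R -> Prop) s : J s -> (forall r, J r -> P r) ->
  \forall r \near s, P r.
Proof.
move=> Js JP; have := open_nbhs_nbhs (conj (pr_open pr) Js).
by apply: filterS.
Qed.

Section Point.
Variables (s : R) (Js : J s).

Let A1_gt0 := pr_A1_gt0 pr Js.
Let A3_gt0 := pr_A3_gt0 pr Js.
Let A1n0 : A1 s != 0 := lt0r_neq0 A1_gt0.
Let A3n0 : A3 s != 0 := lt0r_neq0 A3_gt0.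
Let rn0 := pr_rho_neq0 pr Js.
Let dA1 := pr_dA1 pr Js.
Let dA3 := pr_dA3 pr Js.
Let dr := pr_drho pr Js.

Lemma is_derive_A2 : is_derive s 1 A2 (- 2 * rate1 s * A2 s).
Proof.
apply: (@near_eq_is_derive _ _ _ (fun r => (A1 r)^-1)).
  by apply: near_profile => // r Jr; rewrite (pr_A2 pr).
apply: is_derive_eq (is_derive_invf A1n0 dA1) _.
by rewrite (pr_A2 pr) //; field.
Qed.
Let dA2 := is_derive_A2.

Lemma is_derive_A0 : is_derive s 1 A0 (2 * rate0 s * A0 s).
Proof.
apply: (@near_eq_is_derive _ _ _ (fun r => A3 r / (rho r * rho r))).
  by apply: near_profile => // r Jr; rewrite (pr_A0 pr).
apply: is_derive_eq (is_derive_divf _ dA3 (is_derive_mulf dr dr)) _.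
  by rewrite mulf_neq0.
by rewrite (pr_A0 pr) // /rate0; field.
Qed.

Lemma is_derive_diff_lA : is_derive s 1 diff_lA (2 * rate1 s * sum_lA s).
Proof.
apply: is_derive_eq (is_derive_subf (is_derive_mulf (is_derive_cstf _ _) dA1)
                       (is_derive_mulf (is_derive_cstf _ _) dA2)) _.
by rewrite /sum_lA; ring.
Qed.
Let dX := is_derive_diff_lA.

Lemma is_derive_sum_lA : is_derive s 1 sum_lA (2 * rate1 s * diff_lA s).
Proof.
apply: is_derive_eq (is_derive_addf (is_derive_mulf (is_derive_cstf _ _) dA1)
                       (is_derive_mulf (is_derive_cstf _ _) dA2)) _.
by rewrite /diff_lA; ring.
Qed.
Let dY := is_derive_sum_lA.

Lemma is_derive_rate1 : is_derive s 1 rate1 (rate1 s * (sum_lA s - drho s) / rho s).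
Proof.
apply: is_derive_eq (is_derive_divf _ dX (is_derive_mulf (is_derive_cstf _ _) dr)) _.
  by rewrite mulf_neq0 // pnatr_eq0.
by rewrite /rate1; field.
Qed.

Lemma derive1_rate1 : derive1 rate1 s = rate1 s * (sum_lA s - drho s) / rho s.
Proof.
rewrite derive1E; apply: (@derive_val _ _ _ _ _ _ _ _).
exact: is_derive_rate1.
Qed.

Let dZ : is_derive s 1 (fun r => kappa - sum_lA r / 2) (- (rate1 s * diff_lA s)).
Proof.
apply: is_derive_eq (is_derive_subf (is_derive_cstf _ _)
  (is_derive_mulf dY (is_derive_cstf _ _))) _.
by field.
Qed.

Lemma derive1_rate3 :
  derive1 rate3 s = - (rate1 s * diff_lA s + rate3 s * drho s) / rho s.
Proof.
rewrite derive1E; apply: (@derive_val _ _ _ _ _ _ _ _).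
apply: is_derive_eq (is_derive_divf rn0 dZ dr) _.
by rewrite /rate3; field.
Qed.

Lemma derive1_Nrate1 :
  derive1 (fun r => - rate1 r) s = - (rate1 s * (sum_lA s - drho s) / rho s).
Proof.
rewrite derive1E; apply: (@derive_val _ _ _ _ _ _ _ _).
exact: is_derive_oppf is_derive_rate1.
Qed.

Let d2A3 : is_derive s 1 (fun r => 2 * A3 r) (2 * (2 * rate3 s * A3 s)).
Proof.
apply: is_derive_eq (is_derive_mulf (is_derive_cstf _ _) dA3) _.
by rewrite mul0r add0r.
Qed.

Let A3n2 : 2 * A3 s != 0. Proof. by rewrite mulf_neq0 // pnatr_eq0. Qed.

Lemma derive1_christoffel110 :
  derive1 (fun r => - (diff_lA r * A1 r * rho r / (2 * A3 r))) s =
  - ((2 * rate1 s * (diff_lA s + sum_lA s) * rho s + diff_lA s * drho s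
      - 2 * rate3 s * diff_lA s * rho s) * A1 s / (2 * A3 s)).
Proof.
rewrite derive1E; apply: (@derive_val _ _ _ _ _ _ _ _).
apply: is_derive_eq (is_derive_oppf (is_derive_divf _
  (is_derive_mulf (is_derive_mulf dX dA1) dr) d2A3)) _; first exact: A3n2.
by field.
Qed.

Lemma derive1_christoffel220 :
  derive1 (fun r => diff_lA r * A2 r * rho r / (2 * A3 r)) s =
  (2 * rate1 s * (sum_lA s - diff_lA s) * rho s + diff_lA s * drho s
      - 2 * rate3 s * diff_lA s * rho s) * A2 s / (2 * A3 s).
Proof.
rewrite derive1E; apply: (@derive_val _ _ _ _ _ _ _ _).
apply: is_derive_eq (is_derive_divf _
  (is_derive_mulf (is_derive_mulf dX dA2) dr) d2A3) _; first exact: A3n2.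
by field.
Qed.

Lemma derive1_christoffel330 :
  derive1 (fun r => - ((kappa - sum_lA r / 2) * rho r)) s =
  rate1 s * diff_lA s * rho s - (kappa - sum_lA s / 2) * drho s.
Proof.
rewrite derive1E; apply: (@derive_val _ _ _ _ _ _ _ _).
apply: is_derive_eq (is_derive_oppf (is_derive_mulf dZ dr)) _.
by ring.
Qed.

End Point.
End Profile.

(** * Connection, curvature and spinors of a profile *)

Section ProfileGeometry.
Variables (R : realType) (G : lieGroup R 3) (e : 'I_3 -> R -> G) (J : set R).
Variables (l1 l2 kappa : R) (A0 A1 A2 A3 rho drho sdot : R -> R).
Hypothesis pr : profile J l1 l2 kappa A0 A1 A2 A3 rho drho.
Hypothesis sdotE : forall s, J s -> sdot s = rho s / Num.sqrt (A3 s).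

Let A := triple A1 A2 A3.
Let h := @gramZ R G A0 A.
Let chr := christoffel l1 l2 kappa A1 A2 A3 rho drho.
Let f1 := rate1 l1 l2 A1 A2 rho.
Let f3 := rate3 l1 l2 kappa A1 A2 rho.
Let f0 := rate0 l1 l2 kappa A1 A2 rho drho.

Definition christoffelZ (a b k : 'I_(1 + 3)) (p : R * G) : R := chr p.1 a b k.

Let zE := (val_z0, val_rshift1, split_z0, split_rshift1).

Lemma frameZ_christoffel0 a b k p :
  frameZ e z0 (christoffelZ a b k) p = derive1 (fun r => chr r a b k) p.1.
Proof. exact: frameZ_z0. Qed.

Lemma frameZ_christoffel i a b k p :
  frameZ e (rshift 1 i) (christoffelZ a b k) p = 0.
Proof. exact: (frameZ_fst e i (fun r => chr r a b k)). Qed.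

(** Half the logarithmic derivatives of the four diagonal metric coefficients. *)
Definition rateZ (s : R) (a : nat) : R :=
  match a with 0%N => f0 s | 1%N => f1 s | 2%N => - f1 s | _ => f3 s end.

Lemma is_derive_diagZ a s : J s ->
  is_derive s 1 (diagZ A0 A a) (2 * rateZ s a * diagZ A0 A a s).
Proof.
move=> Js; move: a; apply: ord13P; rewrite /diagZ !zE /rateZ /A /f0 /f1 /f3 /triple /=.
- by refine (is_derive_A0 pr Js).
- by refine (pr_dA1 pr Js).
- by apply: is_derive_eq (is_derive_A2 pr Js) _; ring.
- by refine (pr_dA3 pr Js).
Qed.

(** The metric is constant along e_i. *)
Lemma christoffel_skew (i : 'I_3) (b d : 'I_(1 + 3)) s : J s ->
  chr s (rshift 1 i) d b * diagZ A0 A b s =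
  - (chr s (rshift 1 i) b d * diagZ A0 A d s).
Proof.
move=> Js.
have A1n0 := lt0r_neq0 (pr_A1_gt0 pr Js).
have A3n0 := lt0r_neq0 (pr_A3_gt0 pr Js).
have rn0 := pr_rho_neq0 pr Js.
move: i b d; apply: ord3P; do 2![apply: ord13P];
  rewrite /diagZ !zE /chr /christoffel /A /triple /= ?mul0r ?oppr0 //;
  rewrite ?(pr_A0 pr Js) /rate1 /rate3 /diff_lA /sum_lA ?(pr_A2 pr Js).
all: by field; rewrite ?A1n0 ?A3n0 ?rn0.
Qed.

Lemma levi_civitaZ :
  levi_civita (domZ J) (frameZ e) (lift_constZ (milnor_const l1 l2 0)) h
    christoffelZ.
Proof.
move=> [s x] [/= Js _].
have A1n0 := lt0r_neq0 (pr_A1_gt0 pr Js).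
have A3n0 := lt0r_neq0 (pr_A3_gt0 pr Js).
split=> a b.
  move=> k; move: a b k; do 3![apply: ord13P];
    rewrite /christoffelZ /lift_constZ !zE ?milnor_constE /chr /christoffel /=;
    rewrite ?subrr // /diff_lA /sum_lA ?(pr_A2 pr Js); by field.
move=> d.
have -> : \sum_k (christoffelZ a b k (s, x) * h k d (s, x) +
                  christoffelZ a d k (s, x) * h b k (s, x)) =
    chr s a b d * diagZ A0 A d s + chr s a d b * diagZ A0 A b s.
  rewrite big_split /= (bigD1 d) //= big1 ?addr0 => [|k kd]; last first.
    by rewrite /h gramZE (negbTE kd) mul0r mulr0.
  rewrite (bigD1 b) //= big1 ?addr0 => [|k kb]; last first.
    by rewrite /h gramZE eq_sym (negbTE kb) mul0r mulr0.
  by rewrite /h !gramZE !eqxx !mul1r.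
have -> : h b d = fun p => (b == d)%:R * diagZ A0 A b p.1.
  by apply/funext => p; rewrite /h gramZE.
have E0 : frameZ e z0 (fun p => (b == d)%:R * diagZ A0 A b p.1) (s, x) =
          (b == d)%:R * (2 * rateZ s b * diagZ A0 A b s).
  rewrite frameZ_z0 /= derive1E; apply: (@derive_val _ _ _ _ _ _ _ _).
  apply: is_derive_eq (is_derive_mulf (is_derive_cstf _ _) (is_derive_diagZ b Js)) _.
  by rewrite mul0r add0r.
move: a; apply: ord13P.
  rewrite E0; move: b d {E0}; do 2![apply: ord13P];
    rewrite ?eq_rshift ?eq_lrshift ?eq_rlshift ?eqxx /diagZ !zE
      /chr /christoffel /rateZ /f0 /f1 /f3 /A /triple /=; by ring.
all: rewrite (frameZ_fst e _ (fun r => (b == d)%:R * diagZ A0 A b r)).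
all: by rewrite (christoffel_skew _ b d Js) subrr.
Qed.

(** The first-order system turns the derivatives of the connection
    coefficients into rational expressions in A1, A3, rho and drho, and then
    the Ricci tensor vanishes identically. *)
Lemma ricci_flatZ a b p : domZ J p ->
  ricci (frameZ e) (lift_constZ (milnor_const l1 l2 0)) christoffelZ a b p = 0.
Proof.
case: p => [s x] [/= Js _].
have A1n0 := lt0r_neq0 (pr_A1_gt0 pr Js).
have A3n0 := lt0r_neq0 (pr_A3_gt0 pr Js).
have rn0 := pr_rho_neq0 pr Js.
have D110 := derive1_christoffel110 pr Js.
have D220 := derive1_christoffel220 pr Js.
have D330 := derive1_christoffel330 pr Js.
have Df1 := derive1_rate1 pr Js; have DNf1 := derive1_Nrate1 pr Js.
have Df3 := derive1_rate3 pr Js.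
rewrite ricciE; last exact: frameZ_cst.
rewrite sum13E !frameZ_christoffel !sum13E.
move: a b; do 2![apply: ord13P];
  rewrite ?frameZ_christoffel0 ?frameZ_christoffel /christoffelZ /lift_constZ;
  rewrite !zE ?milnor_constE /chr /christoffel /=.
all: rewrite ?derive1_cst ?D110 ?D220 ?D330 ?Df1 ?DNf1 ?Df3.
all: rewrite /rate0 /rate1 /rate3 /diff_lA /sum_lA ?(pr_A2 pr Js).
all: by field; rewrite ?A1n0 ?A3n0 ?rn0.
Qed.

(** The extension that is constant in s in the trivialization by the orthonormal
    frame. *)
Definition lift_spinor (psi : G -> 'cV[R[i]]_2) (p : R * G) : 'cV[R[i]]_(2 + 2) :=
  col_mx (psi p.2) 0.

Lemma smooth_lift_spinor psi : smooth_spinor (@smooth_fun R 3 G) psi ->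
  smooth_spinor (smooth_funZ J) (lift_spinor psi).
Proof.
move=> smpsi j; rewrite -(splitK j); case: (fintype.split j) => k /=.
  have [smRe smIm] := smpsi k.
  have E q : lift_spinor psi q (lshift 2 k) 0 = psi q.2 k 0.
    by rewrite /lift_spinor col_mxEu.
  split.
    rewrite (_ : (fun q => _) = fun q => complex.Re (psi q.2 k 0)); last first.
      by apply/funext => q; rewrite E.
    move=> c Ac m; exact: (@Ck_snd _ R^o _ _ m J _ _ (smRe c Ac m)).
  rewrite (_ : (fun q => _) = fun q => complex.Im (psi q.2 k 0)); last first.
    by apply/funext => q; rewrite E.
  move=> c Ac m; exact: (@Ck_snd _ R^o _ _ m J _ _ (smIm c Ac m)).
have E q : lift_spinor psi q (rshift 2 k) 0 = 0.
  by rewrite /lift_spinor col_mxEd mxE.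
split; rewrite (_ : (fun q => _) = fun=> 0) ?[_ 0]/=.
all: try by (apply/funext => q; rewrite E).
all: by move=> c Ac m; exact: Ck_cst.
Qed.

Lemma spinor_deriv_lift0 psi p :
  spinor_deriv (frameZ e) z0 (lift_spinor psi) p = 0.
Proof.
apply/colP => j; rewrite !mxE !frameZ_z0 /lift_spinor /=.
by rewrite !derive1_cst.
Qed.

Lemma spinor_deriv_lift i psi p :
  spinor_deriv (frameZ e) (rshift 1 i) (lift_spinor psi) p =
  col_mx (spinor_deriv (frame e) i psi p.2) 0.
Proof.
apply/colP => j; rewrite mxE !frameZ_rshift1 -(splitK j).
case: (fintype.split j) => k /=.
  rewrite col_mxEu mxE; congr (frame e i _ p.2 +i* frame e i _ p.2)%C;
    by apply/funext => q; rewrite /lift_spinor col_mxEu.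
rewrite col_mxEd mxE.
have E f : frame e i (fun x : G => f (lift_spinor psi (p.1, x) (rshift 2 k) 0)) p.2 = 0 :> R.
  rewrite (_ : (fun x => _) = fun=> f 0) ?frame_cst //.
  by apply/funext => q; rewrite /lift_spinor col_mxEd mxE.
by rewrite (E (@complex.Re R)) (E (@complex.Im R)).
Qed.

(** The components g (nabla_(E_a) eps_b, eps_d) that define the spin
    connection. *)
Definition connection_form (a b d : 'I_(1 + 3)) (p : R * G) : R :=
  inner h (nabla (frameZ e) christoffelZ a (orthoZ sdot A b)) (orthoZ sdot A d) p.

Lemma connection_formE a b d p : connection_form a b d p =
  ((if b == d then frameZ e a (fun q => normZ A sdot b q.1) p else 0)
   + normZ A sdot b p.1 * chr p.1 a b d) * normZ A sdot d p.1 * diagZ A0 A d p.1.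
Proof.
by rewrite /connection_form inner_orthoZ nabla_orthoZ // => q; exact: frameZ_cst.
Qed.

Lemma A_gt0 i s : J s -> 0 < A i s.
Proof.
move=> Js; rewrite /A /triple; move: i; apply: ord3P => /=.
- exact: pr_A1_gt0 pr _ Js.
- by rewrite (pr_A2 pr Js) invr_gt0; exact: pr_A1_gt0 pr _ Js.
- exact: pr_A3_gt0 pr _ Js.
Qed.

Lemma is_derive_normZ a s : J s ->
  is_derive s 1 (normZ A sdot a) (- rateZ s a * normZ A sdot a s).
Proof.
move=> Js; move: a; apply: ord1_3P => [|i].
  rewrite /normZ !zE /=.
  have A3_gt0 := pr_A3_gt0 pr Js; have rn0 := pr_rho_neq0 pr Js.
  have sq0 : Num.sqrt (A3 s) != 0 by rewrite sqrtr_eq0 -ltNge.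
  have sqE : A3 s = Num.sqrt (A3 s) ^+ 2 by rewrite sqr_sqrtr // ltW.
  apply: (@near_eq_is_derive _ _ _ (fun r => rho r / Num.sqrt (A3 r))).
    by apply: (near_profile pr Js) => r Jr; rewrite sdotE.
  apply: is_derive_eq (is_derive_divf _ (pr_drho pr Js)
    (is_derive_sqrtf A3_gt0 (pr_dA3 pr Js))) _; first exact: sq0.
  rewrite sdotE // /f0 /rate0 [X in _ * X / _]sqE.
  by field; rewrite sq0.
have Ai_gt0 := A_gt0 i Js.
have sq0 : Num.sqrt (A i s) != 0 by rewrite sqrtr_eq0 -ltNge.
have sqE : A i s = Num.sqrt (A i s) ^+ 2 by rewrite sqr_sqrtr // ltW.
have dA : is_derive s 1 (A i) (2 * rateZ s i.+1 * A i s).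
  by have := is_derive_diagZ (rshift 1 i) Js; rewrite /diagZ !zE.
rewrite /normZ !zE.
apply: is_derive_eq (is_derive_invf _ (is_derive_sqrtf Ai_gt0 dA)) _.
  exact: sq0.
rewrite [X in - (_ * X / _)]sqE.
by field; rewrite sq0.
Qed.

(** For a diagonal metric the normalized frame is parallel along d/ds. *)
Lemma connection_form_z0 b d p : domZ J p -> connection_form z0 b d p = 0.
Proof.
move=> [Jp _]; rewrite connection_formE; case: eqP => [<-|/eqP bd].
  rewrite frameZ_z0 derive1E.
  rewrite (@derive_val _ _ _ _ _ _ _ (is_derive_normZ b Jp)).
  have -> : chr p.1 z0 b b = rateZ p.1 b by rewrite zE; move: b; apply: ord13P.
  by rewrite mulNr [rateZ _ _ * _]mulrC addNr !mul0r.
rewrite add0r (_ : chr _ _ _ _ = 0) ?mulr0 ?mul0r // zE.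
by move: b d bd; do 2![apply: ord13P]; rewrite ?eqxx.
Qed.

Lemma connection_form_rshift1 i b d p : connection_form (rshift 1 i) b d p =
  normZ A sdot b p.1 * normZ A sdot d p.1 *
  (chr p.1 (rshift 1 i) b d * diagZ A0 A d p.1).
Proof.
by rewrite connection_formE (frameZ_fst e i (normZ A sdot b)) if_same add0r; ring.
Qed.

Lemma connection_form_skew i b d p : domZ J p ->
  connection_form (rshift 1 i) d b p = - connection_form (rshift 1 i) b d p.
Proof.
move=> [Jp _]; rewrite !connection_form_rshift1 (christoffel_skew _ b d Jp) mulrN.
by rewrite [normZ A sdot d _ * _]mulrC.
Qed.

(** The first-order system, read on the connection: the self-dual part of the
    connection form does not depend on s. *)
Lemma self_dual_connection_form i p : domZ J p ->
  [/\ connection_form (rshift 1 i) z0 (rshift 1 i0) p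
        + connection_form (rshift 1 i) (rshift 1 i1) (rshift 1 i2) p = 0,
      connection_form (rshift 1 i) z0 (rshift 1 i1) p
        + connection_form (rshift 1 i) (rshift 1 i2) (rshift 1 i0) p = 0 &
      connection_form (rshift 1 i) z0 (rshift 1 i2) p
        + connection_form (rshift 1 i) (rshift 1 i0) (rshift 1 i1) p = triple 0 0 kappa i].
Proof.
case: p => [s x] [/= Js _]; rewrite !connection_form_rshift1 /normZ /diagZ !zE /A /triple /=.
rewrite sdotE // (pr_A2 pr Js).
have A1_gt0 := pr_A1_gt0 pr Js; have A3_gt0 := pr_A3_gt0 pr Js.
have rn0 := pr_rho_neq0 pr Js.
rewrite sqrtrV ?ltW // invrK.
have a1n0 : Num.sqrt (A1 s) != 0 by rewrite sqrtr_eq0 -ltNge.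
have a3n0 : Num.sqrt (A3 s) != 0 by rewrite sqrtr_eq0 -ltNge.
have a1E : A1 s = Num.sqrt (A1 s) ^+ 2 by rewrite sqr_sqrtr // ltW.
have a3E : A3 s = Num.sqrt (A3 s) ^+ 2 by rewrite sqr_sqrtr // ltW.
move: i; apply: ord3P; rewrite /chr /christoffel /rate1 /rate3 /diff_lA /sum_lA /=;
  rewrite (pr_A2 pr Js); move: a1E a3E a1n0 a3n0;
  move: (Num.sqrt (A1 s)) (Num.sqrt (A3 s)) => a1 a3 -> -> a1n0 a3n0.
all: by split; field; rewrite ?a1n0 ?a3n0 ?rn0.
Qed.

Lemma orthonormalZ : Defs.orthonormal (domZ J) h (orthoZ sdot A).
Proof.
move=> [s x] [/= Js _] a b; rewrite inner_orthoZ orthoZE !mxE eqxx /=.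
rewrite eq_sym; case: eqP => [<-|_]; last by rewrite mulr0 !mul0r.
rewrite mulr1; move: a; apply: ord1_3P => [|i]; rewrite /normZ /diagZ !zE.
  have A3_gt0 := pr_A3_gt0 pr Js; have rn0 := pr_rho_neq0 pr Js.
  have a3n0 : Num.sqrt (A3 s) != 0 by rewrite sqrtr_eq0 -ltNge.
  rewrite sdotE // (pr_A0 pr Js) /= -[X in _ * (X / _)](sqr_sqrtr (ltW A3_gt0)).
  by field; rewrite rn0 a3n0.
have Ai_gt0 := A_gt0 i Js.
by rewrite -invfM -expr2 sqr_sqrtr ?ltW // mulVf // lt0r_neq0.
Qed.

Section Spinors.
Variable cl : 'I_3 -> 'M[R[i]]_2.
Hypothesis cl3 : clifford3 cl.
Local Open Scope complex_scope.

Lemma spin_nabla_connection_form a psi p :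
  spin_nabla (frameZ e) h christoffelZ (orthoZ sdot A) (clifford4 cl) a
    (lift_spinor psi) p =
  spinor_deriv (frameZ e) a (lift_spinor psi) p +
  4^-1 *: \sum_b \sum_d (connection_form a b d p)%:C *:
    (clifford4 cl b *m clifford4 cl d *m col_mx (psi p.2) 0).
Proof. by []. Qed.

Lemma spin_nablaZ_z0 psi p : domZ J p ->
  spin_nabla (frameZ e) h christoffelZ (orthoZ sdot A) (clifford4 cl) z0
    (lift_spinor psi) p = 0.
Proof.
move=> Jp; rewrite spin_nabla_connection_form spinor_deriv_lift0 add0r big1 ?scaler0 //.
by move=> b _; rewrite big1 // => d _; rewrite connection_form_z0 // scale0r.
Qed.

(** The covariant derivative of an extended spinor is an operator on G. *)
Lemma spin_nablaZ_rshift1 i psi p : domZ J p ->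
  spin_nabla (frameZ e) h christoffelZ (orthoZ sdot A) (clifford4 cl)
    (rshift 1 i) (lift_spinor psi) p =
  col_mx (spinor_deriv (frame e) i psi p.2
          + (triple 0 0 (kappa / 2) i)%:C *: (cl i *m psi p.2)) 0.
Proof.
move=> Jp; rewrite spin_nabla_connection_form spinor_deriv_lift.
rewrite (spin4_action cl3 (w := fun b d => connection_form (rshift 1 i) b d p)); last first.
  by move=> b d; exact: connection_form_skew.
have [W0 W1 W2] := self_dual_connection_form i Jp.
have col0 (a b c : 'cV[R[i]]_2) : b = c ->
    col_mx a 0 + col_mx b 0 = col_mx (a + c) 0 :> 'cV[R[i]]_(2 + 2).
  by move=> ->; rewrite add_col_mx addr0.
apply: col0; rewrite W0 W1 W2.
pose w := fun j : 'I_3 => if j == i2 then triple 0 0 kappa i else 0.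
apply: etrans (half_combination1 (w := w) (fun j => cl j *m psi p.2) (i := i) _) _.
  by move=> j; rewrite /w; move: (i) j; do 2![apply: ord3P]; rewrite /triple.
congr (_%:C *: _); rewrite /w; move: (i); apply: ord3P; rewrite /triple /= ?mul0r //.
Qed.

End Spinors.

(** At s0 all U_i are 1 and ds/dt is rho, so that rho times the rates are
    U_i' = kappa_i - M_i = - 2 mu Ric_i. *)
Lemma weingartenZ (GamG : 'I_3 -> 'I_3 -> 'I_3 -> G -> R) s0 i x :
  J s0 -> A1 s0 = 1 -> A3 s0 = 1 -> l1 + l2 != 0 ->
  kappa = 2 * l1 * l2 / (l1 + l2) ->
  levi_civita setT (frame e) (lift_const (milnor_const l1 l2 0)) (@gram R G) GamG ->
  - nabla (frameZ e) christoffelZ (rshift 1 i) (orthoZ sdot A z0) (s0, x) =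
  row_mx 0 (2 * - (1 / (2 * (l1 + l2))) *:
              ricci_endo e (milnor_const l1 l2 0) GamG i x).
Proof.
move=> Js A11 A31 l12 kE lc; apply/rowP => k; rewrite mxE nabla_orthoZ; last first.
  by move=> q; exact: frameZ_cst.
rewrite (frameZ_fst e i (normZ A sdot z0)) if_same add0r.
have rn0 := pr_rho_neq0 pr Js.
rewrite /normZ /christoffelZ !zE /= sdotE // A31 sqrtr1 divr1.
move: k; apply: ord1_3P => [|j].
  by rewrite row_mxEl mxE !zE; move: i; apply: ord3P; rewrite /chr /= mulr0 oppr0.
rewrite row_mxEr !mxE (ricci_milnor lc) !zE.
move: i j; do 2![apply: ord3P];
  rewrite /chr /christoffel /triple /= ?mul0r ?mulr0 ?oppr0 //;
  rewrite /rate1 /rate3 /diff_lA /sum_lA (pr_A2 pr Js) A11 ?kE.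
all: by field; rewrite rn0 l12.
Qed.

End ProfileGeometry.

(** * Ricci Killing spinors on the group *)

Section RicciKilling.
Variables (R : realType) (G : lieGroup R 3) (e : 'I_3 -> R -> G) (l1 l2 : R).
Variables (GamG : 'I_3 -> 'I_3 -> 'I_3 -> G -> R) (cl : 'I_3 -> 'M[R[i]]_2).
Hypothesis lc :
  levi_civita setT (frame e) (lift_const (milnor_const l1 l2 0)) (@gram R G) GamG.
Hypothesis cl3 : clifford3 cl.
Local Open Scope complex_scope.

Lemma inner_gram_std X d (x : G) : inner (@gram R G) X (@std_frame R G d) x = X x 0 d.
Proof.
rewrite /inner (bigD1 d) //= [X in _ + X]big1 => [|a ad].
  rewrite addr0 (bigD1 d) //= big1 => [|b bd].
    by rewrite /gram !mxE !eqxx !mulr1 addr0.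
  by rewrite /gram eq_sym (negbTE bd) mulr0.
rewrite big1 // => b _; rewrite /gram mxE eqxx /=.
by have [->|] := eqVneq b d; [rewrite (negbTE ad) mulr0|rewrite mulr0 mul0r].
Qed.

Lemma nablaGE i psi x : nablaG e GamG cl i psi x =
  spinor_deriv (frame e) i psi x +
  (triple ((l2 - l1) / 4) ((l1 - l2) / 4) ((l1 + l2) / 4) i)%:C *: (cl i *m psi x).
Proof.
rewrite /nablaG /spin_nabla.
have E b d : inner (@gram R G) (nabla (frame e) GamG i (@std_frame R G b))
    (@std_frame R G d) x = GamG i b d x.
  by rewrite inner_gram_std nabla_delta ?mxE // => *; exact: frame_cst.
have GE a b k : GamG a b k x = let c := milnor_table l1 l2 in
     (c a b k - c b k a + c k a b) / 2.
  by rewrite (levi_civita_gramE lc) !milnor_constE.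
congr (_ + _); rewrite (eq_bigr (fun b => \sum_d (GamG i b d x)%:C *:
    (cl b *m cl d *m psi x))); last first.
  by move=> b _; apply: eq_bigr => d _; rewrite E.
rewrite (spin3_action cl3 (w := fun b d => GamG i b d x)); last first.
  move=> b d; rewrite !GE; move: i b d {E}; do 3![apply: ord3P]; rewrite /milnor_table /=; ring.
pose w := triple (GamG i i1 i2 x) (GamG i i2 i0 x) (GamG i i0 i1 x).
apply: etrans (half_combination1 (w := w) (fun j => cl j *m psi x) (i := i) _) _.
  rewrite /w !GE; move: (i); do 2![apply: ord3P]; rewrite /milnor_table /triple ?eqxx //= => _; by field.
suff -> : w i / 2 = triple ((l2 - l1) / 4) ((l1 - l2) / 4) ((l1 + l2) / 4) i by [].
rewrite /w !GE; move: (i); apply: ord3P; rewrite /milnor_table /triple /=.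
all: by field.
Qed.

Lemma cliff_ricci i x :
  cliff cl (ricci_endo e (milnor_const l1 l2 0) GamG i x) =
  (triple ((l1 ^+ 2 - l2 ^+ 2) / 2) ((l2 ^+ 2 - l1 ^+ 2) / 2)
          (- (l1 - l2) ^+ 2 / 2) i)%:C *: cl i.
Proof.
rewrite /cliff (bigD1 i) //= mxE (ricci_milnor lc) eqxx mul1r big1 ?addr0 //.
move=> j ji; rewrite mxE (ricci_milnor lc) eq_sym (negbTE ji) mul0r.
exact: scale0r.
Qed.

(** The Ricci Killing equation and the parallel equation differ by the identity
    mu Ric_i - M_i / 2 = - kappa_i / 2. *)
Lemma ricci_killing_deriv psi i x : l1 + l2 != 0 ->
  ricci_killing e (milnor_const l1 l2 0) GamG cl (- (1 / (2 * (l1 + l2)))) psi ->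
  spinor_deriv (frame e) i psi x
    + (triple 0 0 (2 * l1 * l2 / (l1 + l2) / 2) i)%:C *: (cl i *m psi x) = 0.
Proof.
move=> l12 [_ _ _ /(_ i x)]; rewrite nablaGE cliff_ricci -scalemxAl scalerA.
set d := spinor_deriv _ _ _ _ => /eqP; rewrite -subr_eq0 -addrA -scalerBl.
rewrite -!rmorphM -rmorphB => /eqP <-; congr (_ + _%:C *: _).
move: (i); apply: ord3P; rewrite /triple /=; field => //.
Qed.

End RicciKilling.

(** * The extension of a profile *)

Section Extension.
Variables (R : realType) (G : lieGroup R 3) (e : 'I_3 -> R -> G) (l1 l2 : R).
Variables (GamG : 'I_3 -> 'I_3 -> 'I_3 -> G -> R) (cl : 'I_3 -> 'M[R[i]]_2).
Hypothesis mf : milnor_frame e l1 l2 0.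
Hypothesis lc :
  levi_civita setT (frame e) (lift_const (milnor_const l1 l2 0)) (@gram R G) GamG.
Hypothesis cl3 : clifford3 cl.
Hypothesis l12 : l1 + l2 != 0.
Local Open Scope complex_scope.

Let kappa := 2 * l1 * l2 / (l1 + l2).

(** Both the lift of psi and the self-dual part of the connection are constant
    in s, so that the equations on psi make the lift parallel everywhere. *)
Theorem profile_extension (J : set R) (s0 : R) (A0 A1 A2 A3 rho drho sdot : R -> R)
    (spinors : (G -> 'cV[R[i]]_2) -> Prop) :
  profile J l1 l2 kappa A0 A1 A2 A3 rho drho ->
  (forall s, J s -> sdot s = rho s / Num.sqrt (A3 s)) ->
  J s0 -> A1 s0 = 1 -> A3 s0 = 1 ->
  (forall psi, spinors psi -> smooth_spinor (@smooth_fun R 3 G) psi) ->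
  (forall psi, spinors psi -> forall i x, spinor_deriv (frame e) i psi x
     + (triple 0 0 (kappa / 2) i)%:C *: (cl i *m psi x) = 0) ->
  ricci_flat_extension J e (milnor_const l1 l2 0) GamG cl
    (- (1 / (2 * (l1 + l2)))) s0 A0 (triple A1 A2 A3) sdot spinors.
Proof.
move=> pr sdotE Js0 A11 A31 smooth_sp parallel_sp.
exists (lift_constZ (milnor_const l1 l2 0)).
exists (christoffelZ l1 l2 kappa A1 A2 A3 rho drho).
split; split.
- exact: frame_bracketsZ (pr_open pr) mf.
- exact: levi_civitaZ pr.
- exact: orthonormalZ pr sdotE.
- move=> i j x; rewrite gramZE eq_rshift /gram /diagZ split_rshift1 /=.
  suff -> : triple A1 A2 A3 i s0 = 1 by rewrite mulr1.
  by move: (i); apply: ord3P; rewrite /triple //= (pr_A2 pr Js0) A11 invr1.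
- by move=> a b p Jp; exact: (ricci_flatZ e pr).
- move=> psi Spsi; exists (lift_spinor psi); split.
  + exact/smooth_lift_spinor/smooth_sp.
  + by move=> p _; rewrite /lift_spinor col_mxKd.
  + apply: ord1_3P => [|i] p Jp; first exact: (spin_nablaZ_z0 e pr sdotE).
    by rewrite (spin_nablaZ_rshift1 e pr sdotE cl3) // parallel_sp // col_mx0.
  + by move=> x; rewrite /restriction /lift_spinor col_mxKu.
- by move=> i x; exact: (weingartenZ pr sdotE _ _ Js0 A11 A31 l12 erefl lc).
Qed.

Lemma ricci_killing_extension (J : set R) (s0 : R) (A0 A1 A2 A3 rho drho sdot : R -> R) :
  let mu := - (1 / (2 * (l1 + l2))) in
  profile J l1 l2 kappa A0 A1 A2 A3 rho drho ->
  (forall s, J s -> sdot s = rho s / Num.sqrt (A3 s)) ->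
  J s0 -> A1 s0 = 1 -> A3 s0 = 1 ->
  ricci_flat_extension J e (milnor_const l1 l2 0) GamG cl mu
    s0 A0 (triple A1 A2 A3) sdot
    (nonkilling_ricci_killing e (milnor_const l1 l2 0) GamG cl mu).
Proof.
move=> mu pr sdotE Js0 A11 A31; apply: profile_extension pr sdotE Js0 A11 A31 _ _.
  by move=> psi [[]].
by move=> psi [rk _] i x; exact: ricci_killing_deriv lc cl3 _ _ _ l12 rk.
Qed.

End Extension.

(** * Solutions of the first-order system *)

Section Profiles.
Variable R : realType.

(** With T' = 1 - eps T^2 and A1 = q T / l1, where q^2 = eps l1 l2, one has
    l1 A1 = q T and l2 A2 = eps q / T, so that rho = - eps q solves the equation
    for A1; that for A3 becomes linear, with the integrating factors D (with
    logarithmic derivative eps T + 1 / T) and an exponential. *)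
Lemma trig_profile (J : set R) (l1 l2 q eps C s0 : R) (T D : R -> R) :
  let F := fun s => C * D s * expR (- (4 * q / (l1 + l2) * (s - s0))) in
  open J -> 0 < l1 -> 0 < q -> 0 < C -> l1 + l2 != 0 ->
  eps ^+ 2 = 1 -> q ^+ 2 = eps * l1 * l2 ->
  (forall s, J s -> 0 < T s) -> (forall s, J s -> 0 < D s) ->
  (forall s, J s -> is_derive s 1 T (1 - eps * T s ^+ 2)) ->
  (forall s, J s -> is_derive s 1 D ((eps * T s + (T s)^-1) * D s)) ->
  profile J l1 l2 (2 * l1 * l2 / (l1 + l2)) F
    (fun s => q / l1 * T s) (fun s => l1 / (q * T s)) (fun s => F s * q ^+ 2)
    (fun=> - eps * q) (fun=> 0).
Proof.
move=> F oJ l10 q0 C0 l12 eps2 q2 T0 D0 dT dD.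
have F0 s : J s -> 0 < F s.
  by move=> Js; rewrite /F !mulr_gt0 ?D0 ?expR_gt0.
have eps0 : eps != 0 by apply: contra_eq_neq eps2 => ->; rewrite expr0n eq_sym oner_neq0.
have l1n0 := lt0r_neq0 l10; have qn0 := lt0r_neq0 q0.
have l2E : l2 = eps * q ^+ 2 / l1.
  by rewrite q2 !mulrA -expr2 eps2 mul1r mulrAC divff // mul1r.
have epsP : eps = 1 \/ eps = -1.
  by move/eqP: eps2; rewrite sqrf_eq1 => /orP[]/eqP; [left|right].
split=> // s Js; have Tn0 := lt0r_neq0 (T0 s Js); have Dn0 := lt0r_neq0 (D0 s Js).
- by rewrite !mulr_gt0 ?invr_gt0 ?T0.
- by rewrite mulr_gt0 ?F0 // exprn_gt0.
- by rewrite mulf_neq0 // oppr_eq0.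
- by field; rewrite qn0 l1n0 Tn0.
- by rewrite exprMn sqrrN eps2 mul1r mulfK // expf_neq0.
- apply: is_derive_eq (is_derive_mulf (is_derive_cstf _ _) (dT s Js)) _.
  rewrite /rate1 /diff_lA l2E.
  by case: epsP => ->; field; rewrite qn0 l1n0 Tn0.
- have dE : is_derive s 1 (fun r => expR (- (4 * q / (l1 + l2) * (r - s0))))
      (expR (- (4 * q / (l1 + l2) * (s - s0))) * - (4 * q / (l1 + l2))).
    apply: is_derive_comp; apply: is_derive_eq (is_derive_oppf (is_derive_mulf
      (is_derive_cstf _ _) (is_derive_subf (is_derive_id _ _) (is_derive_cstf _ _)))) _.
    by rewrite mul0r add0r subr0 mulr1.
  apply: is_derive_eq (is_derive_mulf (is_derive_mulf (is_derive_mulf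
    (is_derive_cstf _ C) (dD s Js)) dE) (is_derive_cstf _ _)) _.
  rewrite /rate3 /sum_lA /F; move: (expR _) => E.
  move: l12; move: (l1 + l2) => d dn0; rewrite l2E.
  by case: epsP => ->; field; rewrite dn0 qn0 l1n0 Tn0.
- exact: is_derive_cstf.
Qed.

End Profiles.

Section Heisenberg.
Variables (R : realType) (l1 : R).

Let w (t : R) : R := 1 - 3 * l1 / 2 * t.
Let A1 t := w t `^ (- (2 / 3)).
Let A2 t := w t `^ (2 / 3).

(** Here t is the arc length, so rho = U_3 = w^(1/3); then w = rho^3 and
    A1 = rho^-2, and all equations are monomial in rho. *)
Lemma heis_profile (J : set R) : open J -> (forall t, J t -> 0 < w t) ->
  exists rho drho, profile J l1 0 (2 * l1 * 0 / (l1 + 0)) (fun=> 1) A1 A2 A2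
    rho drho /\ forall s, J s -> 1 = rho s / Num.sqrt (A2 s).
Proof.
move=> oJ w0; pose rho t := w t `^ 3^-1.
exists rho, (fun t => - l1 / (2 * rho t ^+ 2)).
have n3 : (3 : R) != 0 by rewrite pnatr_eq0.
have rho_gt0 t : J t -> 0 < rho t by move=> Jt; rewrite powR_gt0 ?w0.
have A2E t : J t -> A2 t = rho t ^+ 2.
  move=> Jt; rewrite /A2 /rho -powR_mulrn ?powR_ge0 // -powRrM.
  by congr (_ `^ _); field.
have A1E t : A1 t = (A2 t)^-1 by rewrite /A1 powRN.
have wE t : J t -> w t = rho t ^+ 3.
  move=> Jt; rewrite /rho -powR_mulrn ?powR_ge0 // -powRrM mulVf //.
  by rewrite powRr1 // ltW // w0.
have dw (t : R) : is_derive t 1 w (- (3 * l1 / 2)).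
  apply: is_derive_eq (is_derive_subf (is_derive_cstf _ _)
    (is_derive_mulf (is_derive_cstf _ _) (is_derive_id _ _))) _.
  by field.
have dpow (a t : R) : J t ->
    is_derive t 1 (fun t => w t `^ a) (a * w t `^ a / w t * - (3 * l1 / 2)).
  move=> Jt; have wt0 := w0 t Jt.
  apply: is_derive_eq (is_derive_comp (is_derive1_powR a wt0) (dw t)) _.
  rewrite powRD; last by rewrite (gt_eqF wt0) implybT.
  by rewrite powR_inv1 ?ltW // mulrA.
split=> [|s Js]; last first.
  by rewrite A2E // sqrtr_sqr ger0_norm ?ltW ?rho_gt0 // divff // lt0r_neq0 ?rho_gt0.
split=> // s Js; have rn0 := lt0r_neq0 (rho_gt0 s Js).
- by rewrite powR_gt0 ?w0.
- by rewrite powR_gt0 ?w0.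
- exact: rn0.
- by rewrite A1E invrK.
- by rewrite A2E // divff // expf_neq0.
- apply: is_derive_eq (dpow _ s Js) _.
  rewrite -/(A1 s) /rate1 /diff_lA A1E A2E // wE //.
  by field.
- apply: is_derive_eq (dpow _ s Js) _.
  rewrite -/(A2 s) /rate3 /sum_lA A1E A2E // wE // mulr0 mul0r.
  by field.
- apply: is_derive_eq (dpow _ s Js) _.
  rewrite -/(rho s) wE //.
  by field.
Qed.

End Heisenberg.

(** * Hyperbolic and circular functions *)

Section Hyperbolic.
Variable R : realType.
Implicit Types s : R.

Lemma cosh_gt0 s : 0 < cosh s.
Proof. by rewrite divr_gt0 // addr_gt0 ?expR_gt0. Qed.

Lemma sinh_gt0 s : 0 < s -> 0 < sinh s.
Proof.
by move=> s0; rewrite divr_gt0 // subr_gt0 ltr_expR gtrN.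
Qed.

Lemma tanh_gt0 s : 0 < s -> 0 < tanh s.
Proof. by move=> s0; rewrite divr_gt0 ?sinh_gt0 ?cosh_gt0. Qed.

Lemma cosh2Bsinh2 s : cosh s ^+ 2 - sinh s ^+ 2 = 1.
Proof.
rewrite /cosh /sinh expRN; have := expR_gt0 s; move: (expR s) => x x0.
by field; rewrite gt_eqF.
Qed.

Lemma sinh_mul2 s : sinh (2 * s) = 2 * sinh s * cosh s.
Proof.
rewrite /cosh /sinh -mulrN -[2]/(2%:R) !expRM_natl.
by field.
Qed.

Lemma cosh_mul2 s : cosh (2 * s) = cosh s ^+ 2 + sinh s ^+ 2.
Proof.
rewrite /cosh /sinh -mulrN -[2]/(2%:R) !expRM_natl expRN.
have := expR_gt0 s; move: (expR s) => x x0.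
by field; rewrite gt_eqF.
Qed.

Lemma is_derive_expRN s : is_derive s 1 (fun r => expR (- r)) (- expR (- s)).
Proof.
apply: is_derive_eq (is_derive_comp (is_derive_expR _)
  (is_derive_oppf (is_derive_id _ _))) _.
by rewrite mulrN1.
Qed.

Lemma is_derive_sinh s : is_derive s 1 (@sinh R) (cosh s).
Proof.
apply: is_derive_eq (is_derive_mulf (is_derive_subf (is_derive_expR s)
  (is_derive_expRN s)) (is_derive_cstf _ _)) _.
by rewrite /cosh; ring.
Qed.

Lemma is_derive_cosh s : is_derive s 1 (@cosh R) (sinh s).
Proof.
apply: is_derive_eq (is_derive_mulf (is_derive_addf (is_derive_expR s)
  (is_derive_expRN s)) (is_derive_cstf _ _)) _.
by rewrite /sinh; ring.
Qed.

Lemma is_derive_tanh s : is_derive s 1 (@tanh R) (1 - tanh s ^+ 2).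
Proof.
have c0 := lt0r_neq0 (cosh_gt0 s).
apply: is_derive_eq (is_derive_divf c0 (is_derive_sinh s) (is_derive_cosh s)) _.
by rewrite /tanh; field.
Qed.

Lemma is_derive_mul2 s : is_derive s 1 (fun r : R => 2 * r) 2.
Proof.
apply: is_derive_eq (is_derive_mulf (is_derive_cstf _ _) (is_derive_id _ _)) _.
by rewrite mul0r add0r mulr1.
Qed.

(** The logarithmic derivative 2 coth (2 s) is tanh s + coth s. *)
Lemma is_derive_sinh_mul2 s : 0 < s ->
  is_derive s 1 (fun r => sinh (2 * r)) ((tanh s + (tanh s)^-1) * sinh (2 * s)).
Proof.
move=> s0; apply: is_derive_eq (is_derive_comp (is_derive_sinh _) (is_derive_mul2 s)) _.
rewrite sinh_mul2 cosh_mul2 /tanh.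
by field; rewrite !lt0r_neq0 ?sinh_gt0 ?cosh_gt0.
Qed.

Lemma sinh_mul2_tanh s : sinh (2 * s) = 2 * tanh s / (1 - tanh s ^+ 2).
Proof.
have c0 := lt0r_neq0 (cosh_gt0 s); have cs := cosh2Bsinh2 s.
have -> : 1 - tanh s ^+ 2 = (cosh s ^+ 2)^-1.
  have sE : sinh s ^+ 2 = cosh s ^+ 2 - 1 by move: cs; lra.
  by rewrite /tanh expr_div_n sE; field.
by rewrite sinh_mul2 /tanh; field.
Qed.

End Hyperbolic.

Section Circular.
Variable R : realType.
Implicit Types s : R.

Lemma sin_mul2 s : sin (2 * s) = 2 * sin s * cos s.
Proof. by rewrite mulr_natl sin_mulr2n -mulrA mulr_natl mulrC. Qed.

Lemma sin_cos_gt0 s : 0 < s < pi / 2 -> 0 < sin s /\ 0 < cos s.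
Proof.
move=> /[dup] sI /andP[s0 spi]; split; first exact: sin_gt0_pihalf.
by rewrite cos_gt0_pihalf // spi andbT (lt_trans _ s0) // oppr_lt0 divr_gt0 ?pi_gt0.
Qed.

Lemma tan_gt0 s : 0 < s < pi / 2 -> 0 < tan s.
Proof. by move=> /sin_cos_gt0[? ?]; rewrite divr_gt0. Qed.

Lemma sin_mul2_gt0 s : 0 < s < pi / 2 -> 0 < sin (2 * s).
Proof. by move=> /sin_cos_gt0[? ?]; rewrite sin_mul2 !mulr_gt0. Qed.

Lemma is_derive_tan_pihalf s : 0 < s < pi / 2 ->
  is_derive s 1 (@tan R) (1 + tan s ^+ 2).
Proof.
move=> /sin_cos_gt0[_ /lt0r_neq0 c0]; apply: is_derive_eq (is_derive_tan c0) _.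
exact: cos2_tan2.
Qed.

(** The logarithmic derivative 2 cot (2 s) is cot s - tan s. *)
Lemma is_derive_sin_mul2 s : 0 < s < pi / 2 ->
  is_derive s 1 (fun r => sin (2 * r)) ((- tan s + (tan s)^-1) * sin (2 * s)).
Proof.
move=> /sin_cos_gt0[sin0 cos0].
apply: is_derive_eq (is_derive_comp (is_derive_sin _) (is_derive_mul2 s)) _.
rewrite sin_mul2 mulr_natl cos_mulr2n mulr2n /tan.
have cs := cos2Dsin2 s.
have -> : cos s ^+ 2 + cos s ^+ 2 - 1 = cos s ^+ 2 - sin s ^+ 2 by move: cs; lra.
by field; rewrite !lt0r_neq0.
Qed.

Lemma sin_mul2_tan s : 0 < s < pi / 2 ->
  sin (2 * s) = 2 * tan s / (1 + tan s ^+ 2).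
Proof.
move=> /sin_cos_gt0[_ /lt0r_neq0 c0]; rewrite -cos2_tan2 // sin_mul2 /tan.
by field.
Qed.

End Circular.

(** * The three cases *)

Lemma sqrt_div (R : realType) (x y : R) : 0 < x -> 0 < y ->
  Num.sqrt (x / y) = x / Num.sqrt (x * y).
Proof.
move=> x0 y0; have xy0 : 0 < x * y by rewrite mulr_gt0.
have sn0 : Num.sqrt (x * y) != 0 by rewrite sqrtr_eq0 -ltNge.
apply: (mulIf sn0); rewrite mulfVK // -sqrtrM; last by rewrite divr_ge0 ?ltW.
rewrite (_ : x / y * (x * y) = x ^+ 2); last by field; rewrite lt0r_neq0.
by rewrite sqrtr_sqr ger0_norm ?ltW.
Qed.

Section Cases.
Variables (R : realType) (G : lieGroup R 3) (e : 'I_3 -> R -> G) (l1 l2 : R).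
Variables (GamG : 'I_3 -> 'I_3 -> 'I_3 -> G -> R) (cl : 'I_3 -> 'M[R[i]]_2).
Hypothesis mf : milnor_frame e l1 l2 0.
Hypothesis lc :
  levi_civita setT (frame e) (lift_const (milnor_const l1 l2 0)) (@gram R G) GamG.
Hypothesis cl3 : clifford3 cl.

(** The functions tanh and coth both solve T' = 1 - T^2, and they have the same
    D = sinh (2 s). *)
Lemma tanh_extension s0 (T : R -> R) :
  let q := Num.sqrt (l1 * l2) in
  let mu := - (1 / (2 * (l1 + l2))) in
  let F := fun s => `|l1 - l2| / (2 * q ^+ 3) * sinh (2 * s) *
                    expR (- (4 * q / (l1 + l2) * (s - s0))) in
  0 < l1 -> 0 < l2 -> l1 != l2 -> 0 < s0 ->
  T = @tanh R \/ T = (fun s => (tanh s)^-1) ->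
  T s0 = l1 / q ->
  ricci_flat_extension [set s | 0 < s] e (milnor_const l1 l2 0) GamG cl mu s0
    F (triple (fun s => q / l1 * T s) (fun s => l1 / (q * T s))
              (fun s => F s * q ^+ 2))
    (fun s => - (q / Num.sqrt (F s * q ^+ 2)))
    (nonkilling_ricci_killing e (milnor_const l1 l2 0) GamG cl mu).
Proof.
move=> q mu F l10 l20 ne s00 TE Ts0.
have q0 : 0 < q by rewrite sqrtr_gt0 mulr_gt0.
have q2 : q ^+ 2 = l1 * l2 by rewrite sqr_sqrtr // ltW // mulr_gt0.
have l1n0 := lt0r_neq0 l10; have l2n0 := lt0r_neq0 l20; have qn0 := lt0r_neq0 q0.
have l12 : l1 + l2 != 0 by rewrite lt0r_neq0 // addr_gt0.
have d0 : 0 < `|l1 - l2| by rewrite normr_gt0 subr_eq0.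
have T0 (s : R) : 0 < s -> 0 < T s.
  by move=> s1; case: TE => ->; rewrite ?invr_gt0 tanh_gt0.
have dT (s : R) : 0 < s -> is_derive s 1 T (1 - 1 * T s ^+ 2).
  move=> s1; rewrite mul1r; case: TE => ->; first exact: is_derive_tanh.
  have t0 := lt0r_neq0 (tanh_gt0 s1).
  by apply: is_derive_eq (is_derive_invf t0 (is_derive_tanh s)) _; field.
have dD (s : R) : 0 < s -> is_derive s 1 (fun r => sinh (2 * r))
    ((1 * T s + (T s)^-1) * sinh (2 * s)).
  move=> s1; apply: is_derive_eq (is_derive_sinh_mul2 s1) _.
  by case: TE => ->; rewrite mul1r ?invrK // [_^-1 + _]addrC.
have l12d : l1 - l2 != 0 by rewrite subr_eq0.
have l21d : l2 - l1 != 0 by rewrite subr_eq0 eq_sym.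
have Ds0 : sinh (2 * s0) = 2 * q / `|l1 - l2|.
  have D0 : 0 < sinh (2 * s0) by rewrite sinh_gt0 // mulr_gt0.
  rewrite -[LHS]gtr0_norm // -[in RHS](gtr0_norm q0) -[2 in RHS]gtr0_norm //.
  rewrite -!normrM -normfV -normrM sinh_mul2_tanh.
  case: TE => TE; move: Ts0; rewrite TE => Ts0.
    rewrite Ts0 expr_div_n q2 -[RHS]normrN; congr `|_|.
    rewrite (_ : l1 / q = q / l2); last first.
      by apply: (mulIf qn0); rewrite mulfVK // mulrAC -expr2 q2 mulfK.
    by field; rewrite ?l12d ?l21d ?l1n0 ?l2n0 ?qn0.
  have -> : tanh s0 = q / l1 by rewrite -[LHS]invrK Ts0 invf_div.
  rewrite expr_div_n q2; congr `|_|.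
  by field; rewrite ?l12d ?l21d ?l1n0 ?l2n0 ?qn0.
have Fs0 : F s0 * q ^+ 2 = 1.
  rewrite /F subrr mulr0 oppr0 expR0 mulr1 Ds0.
  by field; rewrite qn0 lt0r_neq0.
have oJ : open [set s : R | 0 < s] by exact: open_gt.
have C0 : 0 < `|l1 - l2| / (2 * q ^+ 3).
  by rewrite divr_gt0 // mulr_gt0 // exprn_gt0.
have q2' : q ^+ 2 = 1 * l1 * l2 by rewrite mul1r.
have D0 (s : R) : 0 < s -> 0 < sinh (2 * s).
  by move=> s1; rewrite sinh_gt0 // mulr_gt0.
have pr := trig_profile s0 oJ l10 q0 C0 l12 (expr1n _ 2) q2' T0 D0 dT dD.
apply: (ricci_killing_extension mf lc cl3 l12 pr) => //.
- by move=> s _; rewrite mulN1r mulNr.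
- by rewrite Ts0; field; rewrite l1n0 qn0.
Qed.

Lemma tan_extension s0 :
  let q := Num.sqrt (- (l1 * l2)) in
  let mu := - (1 / (2 * (l1 + l2))) in
  let F := fun s => (l1 - l2) / (2 * q ^+ 3) * sin (2 * s) *
                    expR (- (4 * q / (l1 + l2) * (s - s0))) in
  0 < l1 -> l2 < 0 -> l1 + l2 != 0 -> 0 < s0 < pi / 2 -> tan s0 = l1 / q ->
  ricci_flat_extension [set s | 0 < s < pi / 2] e (milnor_const l1 l2 0) GamG cl
    mu s0 F (triple (fun s => q / l1 * tan s) (fun s => l1 / (q * tan s))
              (fun s => F s * q ^+ 2))
    (fun s => q / Num.sqrt (F s * q ^+ 2))
    (nonkilling_ricci_killing e (milnor_const l1 l2 0) GamG cl mu).
Proof.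
move=> q mu F l10 l20 l12 s0I Ts0.
have l120 : 0 < - (l1 * l2) by rewrite oppr_gt0 pmulr_rlt0.
have q0 : 0 < q by rewrite sqrtr_gt0.
have q2 : q ^+ 2 = - (l1 * l2) by rewrite sqr_sqrtr // ltW.
have l1n0 := lt0r_neq0 l10; have qn0 := lt0r_neq0 q0.
have d0 : 0 < l1 - l2 by rewrite subr_gt0 (lt_trans l20).
have dn0 := lt0r_neq0 d0.
have Ds0 : sin (2 * s0) = 2 * q / (l1 - l2).
  have l2E : l2 = - (q ^+ 2 / l1) by rewrite q2 mulNr opprK mulrAC divff // mul1r.
  have sn0 : l1 * l1 - - q ^+ 2 != 0.
    by rewrite opprK lt0r_neq0 // addr_gt0 ?exprn_gt0 // mulr_gt0.
  rewrite sin_mul2_tan // Ts0 [in RHS]l2E.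
  by field; rewrite l1n0 sn0 qn0.
have Fs0 : F s0 * q ^+ 2 = 1.
  rewrite /F subrr mulr0 oppr0 expR0 mulr1 Ds0.
  by field; rewrite qn0 dn0.
have oJ : open [set s : R | 0 < s < pi / 2].
  rewrite (_ : [set s | _] = [set s : R | 0 < s] `&` [set s : R | s < pi / 2]).
    by apply: openI; [exact: open_gt|exact: open_lt].
  by apply/seteqP; split=> [s /andP[]|s [? ?]] //=; apply/andP.
have C0 : 0 < (l1 - l2) / (2 * q ^+ 3).
  by rewrite divr_gt0 // mulr_gt0 // exprn_gt0.
have q2' : q ^+ 2 = - 1 * l1 * l2 by rewrite mulN1r mulNr.
have dT (s : R) : 0 < s < pi / 2 -> is_derive s 1 (@tan R) (1 - - 1 * tan s ^+ 2).
  by move=> sI; apply: is_derive_eq (is_derive_tan_pihalf sI) _; rewrite mulN1r opprK.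
have dD (s : R) : 0 < s < pi / 2 -> is_derive s 1 (fun r => sin (2 * r))
    ((- 1 * tan s + (tan s)^-1) * sin (2 * s)).
  by move=> sI; apply: is_derive_eq (is_derive_sin_mul2 sI) _; rewrite mulN1r.
have e2 : (- 1 : R) ^+ 2 = 1 by rewrite sqrrN expr1n.
have pr := trig_profile s0 oJ l10 q0 C0 l12 e2 q2' (@tan_gt0 R)
  (@sin_mul2_gt0 R) dT dD.
apply: (ricci_killing_extension mf lc cl3 l12 pr) => //.
- by move=> s _; rewrite opprK mul1r.
- by rewrite Ts0; field; rewrite l1n0 qn0.
Qed.

Lemma spinor_deriv_cst i (v : 'cV[R[i]]_2) x : spinor_deriv (frame e) i (fun=> v) x = 0.
Proof. by apply/colP => j; rewrite !mxE !frame_cst. Qed.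

Lemma smooth_spinor_cst (v : 'cV[R[i]]_2) : smooth_spinor (@smooth_fun R 3 G) (fun=> v).
Proof. by move=> j; split=> c Ac k; exact: Ck_cst. Qed.

End Cases.

Theorem mainTheorem8 (R : realType) (G : lieGroup R 3) (e : 'I_3 -> R -> G)
  (l1 l2 l3 : R)
  (GamG : 'I_3 -> 'I_3 -> 'I_3 -> G -> R)
  (cl : 'I_3 -> 'M[R[i]]_2) :
  let cG := milnor_const l1 l2 l3 in
  unimodular cG ->
  milnor_frame e l1 l2 l3 ->
  levi_civita setT (frame e) (lift_const cG) (@gram R G) GamG ->
  clifford3 cl ->
  [/\ (* case (i) *)
      lie_isomorphic cG (heis3 R) -> connected [set: G] ->
      l1 != 0 -> l2 = 0 -> l3 = 0 ->
      forall I : set R, open I -> is_interval I -> I 0 ->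
      (forall t, I t -> 0 < 1 - 3 * l1 / 2 * t) ->
      let mu := - (1 / (2 * l1)) in
      let A1 := fun t => (1 - 3 * l1 / 2 * t) `^ (- (2 / 3)) in
      let A2 := fun t => (1 - 3 * l1 / 2 * t) `^ (2 / 3) in
      ricci_flat_extension I e cG GamG cl mu 0
        (fun=> 1) (triple A1 A2 A2) (fun=> 1) (@nonzero_invariant R G),
      (* case (ii) *)
      lie_isomorphic cG (iso2 R) -> simply_connected R G ->
      0 < l1 -> 0 < l2 -> l1 != l2 -> l3 = 0 ->
      forall s0 : R, 0 < s0 ->
      tanh s0 = (if l1 < l2 then Num.sqrt (l1 / l2) else Num.sqrt (l2 / l1)) ->
      let mu := - (1 / (2 * (l1 + l2))) in
      let q := Num.sqrt (l1 * l2) in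
      let F := fun s => `|l1 - l2| / (2 * q ^+ 3) * sinh (2 * s) *
                        expR (- (4 * q / (l1 + l2) * (s - s0))) in
      let A1 := fun s => if l1 < l2 then q / l1 * tanh s
                         else q / (l1 * tanh s) in
      let A2 := fun s => if l1 < l2 then l1 / (q * tanh s)
                         else l1 / q * tanh s in
      let A3 := fun s => F s * q ^+ 2 in
      let U3 := fun s => Num.sqrt (A3 s) in
      ricci_flat_extension [set s | 0 < s] e cG GamG cl mu s0
        F (triple A1 A2 A3) (fun s => - (q / U3 s))
        (nonkilling_ricci_killing e cG GamG cl mu) &
      (* case (iii) *)
      lie_isomorphic cG (iso11 R) -> simply_connected R G ->
      0 < l1 -> l2 < 0 -> l1 + l2 != 0 -> l3 = 0 ->
      let q := Num.sqrt (- (l1 * l2)) in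
      forall s0 : R, 0 < s0 < pi / 2 -> tan s0 = l1 / q ->
      let mu := - (1 / (2 * (l1 + l2))) in
      let F := fun s => (l1 - l2) / (2 * q ^+ 3) * sin (2 * s) *
                        expR (- (4 * q / (l1 + l2) * (s - s0))) in
      let A1 := fun s => q / l1 * tan s in
      let A2 := fun s => l1 / (q * tan s) in
      let A3 := fun s => F s * q ^+ 2 in
      let U3 := fun s => Num.sqrt (A3 s) in
      ricci_flat_extension [set s | 0 < s < pi / 2] e cG GamG cl mu s0
        F (triple A1 A2 A3) (fun s => q / U3 s)
        (nonkilling_ricci_killing e cG GamG cl mu)].
Proof.
move=> cG _ mf lc cl3; split.
- move=> _ _ l1n0 l20 l30 J oJ _ J0 wpos mu A1 A2.
  move: mf lc; rewrite /cG l20 l30 => mf lc.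
  have [rho [drho [pr rhoE]]] := heis_profile oJ wpos.
  have l12 : l1 + 0 != 0 by rewrite addr0.
  have A0 : 1 - 3 * l1 / 2 * 0 = 1 :> R by rewrite mulr0 subr0.
  rewrite (_ : mu = - (1 / (2 * (l1 + 0)))); last by rewrite /mu addr0.
  apply: (profile_extension mf lc cl3 l12 pr) => //.
  + by rewrite /A1 A0 powR1.
  + by rewrite /A2 A0 powR1.
  + move=> psi [v _ psiE]; rewrite (_ : psi = fun=> v); last exact/funext.
    exact: smooth_spinor_cst.
  + move=> psi [v _ psiE] i x; rewrite (_ : psi = fun=> v); last exact/funext.
    rewrite spinor_deriv_cst add0r (_ : triple _ _ _ _ = 0) ?scale0r //.
    by move: (i); apply: ord3P; rewrite /triple //= mulr0 !mul0r.
- move=> _ _ l10 l20 ne l30 s0 s00 th0 mu q F A1 A2 A3 U3.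
  move: mf lc; rewrite /cG l30 => mf lc.
  have ext T := tanh_extension mf lc cl3 (T := T) l10 l20 ne s00.
  have [l12|l21] := ltP l1 l2.
    rewrite /A1 /A2 l12; apply: ext; first by left.
    by rewrite th0 l12 sqrt_div.
  have n12 : (l1 < l2) = false by rewrite ltNge l21.
  have A1E : A1 = fun s => q / l1 * (tanh s)^-1.
    by apply/funext => s; rewrite /A1 n12; move: (tanh s) => t; rewrite invfM mulrA.
  have A2E : A2 = fun s => l1 / (q * (tanh s)^-1).
    by apply/funext => s; rewrite /A2 n12; move: (tanh s) => t; rewrite invfM invrK mulrA.
  rewrite A1E A2E; apply: ext; first by right.
  have sqrtV : (Num.sqrt (l2 / l1))^-1 = Num.sqrt (l1 / l2).
    by rewrite -sqrtrV ?invf_div // divr_ge0 // ltW.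
  by rewrite th0 n12 sqrtV sqrt_div.
- move=> _ _ l10 l20 l12 l30 q s0 s0I ts0 mu F A1 A2 A3 U3.
  move: mf lc; rewrite /cG l30 => mf lc.
  have ext := tan_extension mf lc cl3 l10 l20 l12 s0I ts0.
  exact: ext.
Qed.
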